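(* Let $\Sigma=\{0,1,2\}^{\mathbb{N}}$ with the shift $\sigma$, let $\alpha>0$, and let $A=A_\alpha:\Sigma\to\mathbb{R}$ be the potential defined by $A(x)=-d(x,0^\infty)$ if $x\in[0]$, $A(x)=-3\,d(x,1^\infty)$ if $x\in[1]$, and $A(x)=-\alpha$ if $x\in[2]$. For $\beta>0$ let $\mu_\beta$ be the unique Gibbs measure (equivalently, the unique equilibrium state) associated to $\beta A$. Let $\rho:=\frac{1+\sqrt5}{2}$. Then, in the weak-* topology: (1) if $\alpha>1$, $\mu_\beta$ converges to $\frac12(\delta_{0^\infty}+\delta_{1^\infty})$ as $\beta\to+\infty$; (2) if $\alpha=1$, $\mu_\beta$ converges to $\frac{1}{1+\rho^2}(\rho^2\delta_{0^\infty}+\delta_{1^\infty})$ as $\beta\to+\infty$; (3) if $0<\alpha<1$, $\mu_\beta$ converges to $\delta_{0^\infty}$ as $\beta\to+\infty$.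
   Context: Points of $\Sigma=\{0,1,2\}^{\mathbb N}$ are sequences $x=(x_0,x_1,\dots)$; $\sigma(x_0,x_1,x_2,\dots)=(x_1,x_2,\dots)$; the distance is $d(x,y)=2^{-\min\{n:\,x_n\ne y_n\}}$ for $x\neq y$ and $d(x,x)=0$. The cylinder $[X_0\ldots X_k]$ is the set of $x$ with $x_i=X_i$ for $0\le i\le k$. The points $0^\infty=(0,0,\dots)$ and $1^\infty=(1,1,\dots)$ are fixed by $\sigma$. An equilibrium state for $\beta A$ is a $\sigma$-invariant Borel probability measure $\mu$ maximizing $h_\nu(\sigma)+\beta\int A\,d\nu$ over all $\sigma$-invariant probability measures $\nu$, where $h_\nu$ is the Kolmogorov–Sinai entropy. Since $A$ is Lipschitz it exists and is unique, and it equals $\mu_\beta=H_\beta\,\nu_\beta$, where, for the transfer operator $\mathcal L_\beta\varphi(x)=\sum_{y:\,\sigma(y)=x}e^{\beta A(y)}\varphi(y)$, $\nu_\beta$ is the probability measure with $\mathcal L_\beta^*\nu_\beta=e^{P(\beta)}\nu_\beta$ and $H_\beta$ is the positive continuous function with $\mathcal L_\beta H_\beta=e^{P(\beta)}H_\beta$ and $\int H_\beta\,d\nu_\beta=1$, $P(\beta)$ being the topological pressure of $\beta A$. *)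

(* Defs.v *)
From HB Require Import structures.
From mathcomp Require Import all_boot all_order all_algebra.
From mathcomp Require Import all_classical all_reals all_analysis.
Set Implicit Arguments.
Unset Strict Implicit.
Unset Printing Implicit Defensive.
Import Order.TTheory GRing.Theory Num.Theory.
Import numFieldNormedType.Exports.
Local Open Scope classical_set_scope.
Local Open Scope ring_scope.

Definition symbol : Type := discrete_topology 'I_3.
HB.instance Definition _ := DiscreteUniform.on symbol.
HB.instance Definition _ := isPointed.Build symbol (ord0 : 'I_3).

(* The topology is the product of the discrete ones; [nbhs_distE] below checks
   that it is the topology of the distance [dist]. *)
Definition Sigma : Type := prod_topology (fun _ : nat => symbol).
HB.instance Definition _ := Pointed.on Sigma.
HB.instance Definition _ := Nbhs.on Sigma.
HB.instance Definition _ := Topological.on Sigma.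
HB.instance Definition _ := Uniform.on Sigma.

Definition BSigma : Type := g_sigma_algebraType (@open Sigma).
HB.instance Definition _ := Pointed.on BSigma.
HB.instance Definition _ := Measurable.on BSigma.

Definition sigma_shift (x : Sigma) : Sigma := fun n => x n.+1.

Definition zeros : Sigma := fun=> (Ordinal (isT : (0 < 3)%N) : 'I_3).
Definition ones : Sigma := fun=> (Ordinal (isT : (1 < 3)%N) : 'I_3).

Definition dist (R : realType) (x y : Sigma) : R :=
  if pselect (exists n, x n != y n) is left h then 2 ^- (ex_minn h) else 0.

Definition potential (R : realType) (alpha : R) (x : Sigma) : R :=
  match nat_of_ord (x 0%N : 'I_3) with
  | 0%N => - dist R x zeros
  | 1%N => - 3 * dist R x ones
  | _ => - alpha
  end.

Section Entropy.
Context (d : measure_display) (T : measurableType d) (R : realType).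
Implicit Types (mu : probability T R) (f : T -> T).

Definition invariant f mu : Prop :=
  forall B : set T, measurable B -> mu (f @^-1` B) = mu B.

(* A finite partition indexed by a finType I is encoded by the map xi sending
   a point to the index of its cell; cells may be empty. *)
Definition measurable_partition (I : finType) (xi : T -> I) : Prop :=
  forall i : I, measurable (xi @^-1` [set i]).

(* The value [ln 0 = 0] is harmless here: the term of a null cell is 0. *)
Definition shannon mu (I : finType) (xi : T -> I) : R :=
  - \sum_(i : I) fine (mu (xi @^-1` [set i])) * ln (fine (mu (xi @^-1` [set i]))).

(* The join of the partitions f^{-i} xi, i < n. *)
Definition join_partition f (I : finType) (xi : T -> I) (n : nat) :
    T -> {ffun 'I_n -> I} :=
  fun x => [ffun i : 'I_n => xi (iter i f x)].

Definition partition_entropy f mu (I : finType) (xi : T -> I) : R :=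
  limn (fun n => shannon mu (join_partition f xi n) / n%:R).

Definition KS_entropy f mu : \bar R :=
  ereal_sup [set h | exists (k : nat) (xi : T -> 'I_k),
    measurable_partition xi /\ h = (partition_entropy f mu xi)%:E].

Definition equilibrium_state f (phi : T -> R) mu : Prop :=
  invariant f mu /\
  forall nu : probability T R, invariant f nu ->
    (KS_entropy f nu + \int[nu]_x (phi x)%:E
       <= KS_entropy f mu + \int[mu]_x (phi x)%:E)%E.

End Entropy.

(* All continuous test functions are allowed: they are bounded, as Sigma is
   compact. *)
Definition weak_star_cvg (R : realType) (I : Type) (mu : I -> probability BSigma R)
    (F : set_system I) (m : {measure set BSigma -> \bar R}) : Prop :=
  forall f : Sigma -> R, continuous f ->
    (\int[mu i]_x (f x)%:E)%E @[i --> F] --> (\int[m]_x (f x)%:E)%E.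

Definition golden (R : realType) : R := (1 + Num.sqrt 5) / 2.

Definition two_deltas (R : realType) (a b : {nonneg R}) :
    {measure set BSigma -> \bar R} :=
  measure_add (mscale a (dirac (zeros : BSigma))) (mscale b (dirac (ones : BSigma))).

Lemma golden_gt0 (R : realType) : 0 < golden R.
Proof. by rewrite /golden divr_gt0// ltr_wpDr// sqrtr_ge0. Qed.

Lemma golden_spec (R : realType) :
  Itv.spec (@Itv.num_sem R) (Itv.Real `]0%Z, +oo[) (golden R).
Proof. by rewrite /= /Itv.num_sem num_real/= in_itv/= golden_gt0. Qed.

(* Lets [%:nng] infer the sign of expressions in the golden ratio. *)
Canonical golden_inum (R : realType) := Itv.mk (golden_spec R).

Lemma dist_lt (R : realType) (x y : Sigma) (n : nat) :
  (dist R x y < 2 ^- n) <-> forall i, (i <= n)%N -> x i = y i.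
Proof.
have h2 m : 0 < 2 ^- m :> R by rewrite invr_gt0 exprn_gt0.
rewrite /dist; case: pselect => [h|nh]; last first.
  split=> // _ i _; apply/eqP; apply: contrapT => /negP hi; apply: nh.
  by exists i.
case: ex_minnP => m hm min.
rewrite ltf_pV2 ?posrE ?exprn_gt0// ltr_eXn2l ?ltr1n//.
split=> [nm i lein|H].
  apply/eqP; apply: contrapT => /negP /min hmi.
  by move: nm; rewrite ltnNge (leq_trans hmi lein).
by rewrite ltnNge; apply/negP => /H e; rewrite e eqxx in hm.
Qed.

Lemma nbhs_distE (R : realType) (x : Sigma) (U : set Sigma) :
  nbhs x U <-> exists2 e : R, 0 < e & forall y, dist R x y < e -> U y.
Proof.
split.
- move=> xU; apply: contrapT => nH.
  have /choice[y Hy] : forall n, exists y : Sigma,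
      (forall i, (i <= n)%N -> x i = y i) /\ ~ U y.
    move=> n; apply: contrapT => nex; apply: nH; exists (2 ^- n).
      by rewrite invr_gt0 exprn_gt0.
    move=> z /dist_lt xz; apply: contrapT => nUz; apply: nex.
    by exists z.
  have yx : y @ \oo --> x.
    apply/cvg_sup => i V [W [[C oC <-] Cx] /filterS]; apply.
    by exists i => // n /= lein; rewrite -((Hy n).1 _ lein).
  have [n _ /(_ n (leqnn n))] := yx _ xU.
  exact: (Hy n).2.
- move=> [e e0 H].
  have [n ne] : exists n, 2 ^- n < e :> R.
    have [n _ /(_ n (leqnn n)) ne] := near_infty_natSinv_expn_lt (PosNum e0).
    by exists n; rewrite -div1r.
  have near_i i : \forall y \near x, x i = y i.
    have := @proj_continuous nat (fun=> symbol) i x.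
    by move=> /(_ _ (discrete_set1 _)); apply: filterS => y /= ->.
  suff : nbhs x [set y : Sigma | forall i, (i <= n)%N -> x i = y i].
    by apply: filterS => y /(dist_lt R) xy; apply: H; exact: lt_trans xy ne.
  elim: n {ne} => [|n IH].
    by apply: filterS (near_i 0%N) => y xy i; rewrite leqn0 => /eqP ->.
  apply: filterS2 IH (near_i n.+1) => y xy xyn i.
  by rewrite leq_eqVlt => /predU1P[->//|]; exact: xy.
Qed.

(* Main.v *)
(** The equilibrium states are never constructed.  If [mu] is an equilibrium
    state for [beta A], then [t mu[0] <= P (beta A + t 1_[0]) - P (beta A)], so
    an upper bound of perturbed pressures and a lower bound of [P (beta A)],
    accurate to leading order, determine the limit of [mu[0]].

    - Upper bound: a positive function [H] with [L_psi H <= lam H] forces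
      [h_mu + \int psi dmu <= ln lam] for all invariant [mu].  Since [A] depends
      only on the length of the initial run, [H] can be written explicitly in
      terms of the distance to the fixed points.
    - Lower bound: a Markov measure on [{0,1,2}] with transition matrix
      [[1-e, p, r], [e, 1-e, 0], [1, 0, 0]], where [r = exp (- beta (1+alpha))],
      [p e = exp (- 4 beta)] and [e = p + r], has free energy at least
      [e (1-e)^2].

    With [a := p / e], the perturbation [t = e s] changes the pressure by
    [e s / (1+a)] to first order in [s], whence [mu[0] - 1 / (1+a)] tends to 0,
    and [a] tends to 1, equals [rho^-2], or tends to 0 in the three cases.
    Finally [\int A dmu >= - ln 3 / beta] shows that [mu] concentrates on the two
    fixed points. *)
From HB Require Import structures.
Require Import Defs.
From mathcomp Require Import all_boot all_order all_algebra.
From mathcomp Require Import all_classical all_reals all_analysis.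
From mathcomp Require Import measurable_realfun ring lra.
Import Order.TTheory GRing.Theory Num.Theory.
Import numFieldNormedType.Exports.
Local Open Scope classical_set_scope.
Local Open Scope ring_scope.

(** * Cylinders and the Borel sets of [Sigma] *)

(** A completed run of 0s costs [beta * (1/2 + 1/4 + ...)], nearly [beta] once it is long; a run of
    1s costs nearly [3 * beta], a symbol 2 costs [alpha * beta]. At pressure [e], the free length of
    a run contributes a factor [1 / e]. So the loops 0-1-0 and 0-2-0 weigh [exp (- 4 beta) / e^2]
    and [exp (- beta (1+alpha)) / e], and these must add up to 1. This renewal equation determines
    [e]; its two terms are the shares [a] and [1 - a] of the loops, and they have the same order
    exactly when [alpha = 1]. The first obstacle is that [e] is exponentially small in [beta]: both
    pressure bounds must be right up to a factor [1 + o(1)], and the perturbation has to be measured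
    in units of [e]. Taking [s] of both signs makes the one-sided convexity inequality two-sided.
    The second obstacle is that the Kolmogorov-Sinai entropy is a supremum over all Borel
    partitions, whereas a supersolution controls cylinders only. Cells are therefore guessed from
    finitely many symbols, and the errors of the guess are charged to the entropy. *)

Definition cyl (n : nat) (y : Sigma) : set BSigma :=
  [set x | forall i, (i < n)%N -> x i = y i].

Lemma nbhs_cyl (R : realType) (x : Sigma) (U : set Sigma) :
  nbhs x U <-> exists n, cyl n x `<=` U.
Proof.
split.
- move=> /(nbhs_distE R) [e e0 H].
  have [n _ /(_ n (leqnn n)) ne] := near_infty_natSinv_expn_lt (PosNum e0).
  exists n.+1 => y yx; apply: H; apply: (lt_trans _ ne); rewrite div1r.
  by apply/dist_lt => i ilen; rewrite yx.
- move=> [n H]; apply/(nbhs_distE R); exists (2 ^- n).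
    by rewrite invr_gt0 exprn_gt0.
  by move=> y /dist_lt yx; apply: H => i /ltnW /yx ->.
Qed.

Lemma open_cyl (R : realType) n (y : Sigma) : open (cyl n y : set Sigma).
Proof.
rewrite openE => x xy; apply/(nbhs_cyl R); exists n => z zx i ilt.
by rewrite zx// xy.
Qed.

Definition word n (x : Sigma) : {ffun 'I_n -> 'I_3} := [ffun i : 'I_n => x i].

Definition unword n (w : {ffun 'I_n -> 'I_3}) : Sigma :=
  fun i => if insub i is Some j then w j else zeros i.

Lemma unwordE n (w : {ffun 'I_n -> 'I_3}) (i : 'I_n) : unword n w i = w i.
Proof. by rewrite /unword valK. Qed.

Lemma wordK n x : cyl n (unword n (word n x)) = cyl n x.
Proof.
have e i : (i < n)%N -> unword n (word n x) i = x i.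
  by move=> ilt; rewrite (unwordE n _ (Ordinal ilt)) ffunE.
by apply/seteqP; split => z zx i ilt; rewrite zx// e.
Qed.

Lemma unwordK n w : word n (unword n w) = w.
Proof. by apply/ffunP => i; rewrite ffunE unwordE. Qed.

Lemma word_cyl n x y : cyl n y x <-> word n x = word n y.
Proof.
split => [xy|xy i ilt]; first by apply/ffunP => i; rewrite !ffunE xy.
by move/ffunP: xy => /(_ (Ordinal ilt)); rewrite !ffunE.
Qed.

(** The empty set is included to make the family a pi-system, as uniqueness of measures requires. *)
Definition cylinders : set (set BSigma) :=
  [set B | B = set0 \/ exists n y, B = cyl n y].

Lemma setI_closed_cylinders : setI_closed cylinders.
Proof.
move=> A B [->|[n [y ->]]]; first by left; rewrite set0I.
move=> [->|[m [z ->]]]; first by left; rewrite setI0.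
have [[x [xy xz]]|/set0P/negP/negPn/eqP] := pselect (cyl n y `&` cyl m z !=set0); last by left.
right; exists (maxn n m), x; apply/seteqP; split => t.
  move=> [ty tz] i; rewrite leq_max => /orP[ilt|ilt].
    by rewrite ty// xy.
  by rewrite tz// xz.
move=> tx; split => i ilt.
  by rewrite tx ?xy// leq_max ilt.
by rewrite tx ?xz// leq_max ilt orbT.
Qed.

(** There are finitely many words of each length, so this is a countable union of cylinders; hence
    cylinders generate the Borel sets. *)
Lemma open_bigcup_cyl (R : realType) (U : set Sigma) : open U ->
  U = \bigcup_n \bigcup_(w in [set w | cyl n (unword n w) `<=` U]) cyl n (unword n w).
Proof.
move=> oU; apply/seteqP; split => x.
  move=> Ux; have /(nbhs_cyl R)[n nU] : nbhs x U by exact: open_nbhs_nbhs.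
  by exists n => //; exists (word n x) => [|]; rewrite /= wordK.
by move=> [n _ [w wU]]; exact: wU.
Qed.

Lemma measurable_cylinders (R : realType) : @measurable _ BSigma = <<s cylinders >>.
Proof.
apply/seteqP; split.
- apply: smallest_sub; first exact: smallest_sigma_algebra.
  move=> U /(open_bigcup_cyl R) ->.
  apply: (@bigcupT_measurable _ (g_sigma_algebraType cylinders)) => n.
  apply: (@fin_bigcup_measurable _ (g_sigma_algebraType cylinders)) => //.
  by move=> w _; apply: sub_sigma_algebra; right; exists n, (unword n w).
- apply: smallest_sub; first exact: sigma_algebra_measurable.
  move=> A [->|[n [y ->]]]; first exact: measurable0.
  by apply: sub_sigma_algebra; exact: open_cyl R _ _.
Qed.

Lemma measurable_cyl (R : realType) n y : measurable (cyl n y).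
Proof. by rewrite (measurable_cylinders R); apply: sub_sigma_algebra; right; exists n, y. Qed.

(** * Real integrals of bounded measurable functions, and invariance *)

Section BoundedIntegral.
Context {d : measure_display} {T : measurableType d} {R : realType}.
Variable P : probability T R.
Implicit Types f g : T -> R.

Definition bdd_mfun f := measurable_fun [set: T] f /\ exists C : R, forall x, `|f x| <= C.

Lemma bdd_mfun_integrable f : bdd_mfun f -> P.-integrable [set: T] (EFin \o f).
Proof.
move=> [mf [C fC]]; apply: measurable_bounded_integrable => //.
  by apply: (@le_lt_trans _ _ 1%E); [rewrite -(probability_setT P)|exact: ltry].
by exists C; split; [exact: num_real|move=> M CM x _ /=; exact: le_trans (fC x) (ltW CM)].
Qed.

Lemma bdd_mfun_cst c : bdd_mfun (fun=> c).
Proof. by split; [exact: measurable_cst|exists `|c|]. Qed.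

Lemma bdd_mfunD f g : bdd_mfun f -> bdd_mfun g -> bdd_mfun (fun x => f x + g x).
Proof.
move=> [mf [C fC]] [mg [D gD]]; split; first exact: measurable_funD.
by exists (C + D) => x; apply: le_trans (ler_normD _ _) (lerD (fC x) (gD x)).
Qed.

Lemma bdd_mfunZ c f : bdd_mfun f -> bdd_mfun (fun x => c * f x).
Proof.
move=> [mf [C fC]]; split; first by apply: measurable_funM => //; exact: measurable_cst.
by exists (`|c| * C) => x; rewrite normrM ler_wpM2l.
Qed.

Lemma bdd_mfun_sum (I : Type) (r : seq I) (F : I -> T -> R) :
  (forall i, bdd_mfun (F i)) -> bdd_mfun (fun x => \sum_(i <- r) F i x).
Proof.
move=> bF; elim: r => [|i r IH].
  by under eq_fun do rewrite big_nil; exact: bdd_mfun_cst.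
by under eq_fun do rewrite big_cons; exact: bdd_mfunD.
Qed.

Lemma bdd_mfun_partition (I : finType) (xi : T -> I) (G : I -> R) :
  measurable_partition xi -> bdd_mfun (G \o xi).
Proof.
move=> mxi; split.
  move=> _ Y _; rewrite setTI.
  rewrite (_ : _ @^-1` Y = \bigcup_(i in [set i | Y (G i)]) (xi @^-1` [set i])).
    by apply: fin_bigcup_measurable => // i _; exact: mxi.
  by apply/seteqP; split => x /=; [exists (xi x)|move=> [i /= Yi ->]].
exists (\sum_i `|G i|) => x /=; rewrite (bigD1 (xi x))//= lerDl.
by apply: sumr_ge0.
Qed.

Local Notation "''E' f" := (\int[P]_x f x) (at level 10, f at level 8).

Lemma Rint_cst c : \int[P]_x c = c.
Proof. by rewrite Rintegral_cst// [X in fine X]probability_setT mulr1. Qed.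

Lemma RintD f g : bdd_mfun f -> bdd_mfun g ->
  \int[P]_x (f x + g x) = 'E f + 'E g.
Proof. by move=> ? ?; rewrite RintegralD//; exact: bdd_mfun_integrable. Qed.

Lemma RintZ c f : bdd_mfun f -> \int[P]_x (c * f x) = c * 'E f.
Proof. by move=> ?; rewrite RintegralZl//; exact: bdd_mfun_integrable. Qed.

Lemma le_Rint f g : bdd_mfun f -> bdd_mfun g -> (forall x, f x <= g x) -> 'E f <= 'E g.
Proof. by move=> ? ? fg; apply: le_Rintegral => //; exact: bdd_mfun_integrable. Qed.

Lemma Rint_sum (I : Type) (r : seq I) (F : I -> T -> R) :
  (forall i, bdd_mfun (F i)) ->
  \int[P]_x (\sum_(i <- r) F i x) = \sum_(i <- r) 'E (F i).
Proof.
move=> bF; elim: r => [|i r IH].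
  by rewrite big_nil -[RHS](Rint_cst 0); apply: eq_Rintegral => x _; rewrite big_nil.
rewrite big_cons -IH -RintD//; last exact: bdd_mfun_sum.
by apply: eq_Rintegral => x _; rewrite big_cons.
Qed.

Lemma bdd_mfun_indic (A : set T) : measurable A -> bdd_mfun (\1_A : T -> R).
Proof.
move=> mA; split; first exact: measurable_indic.
by exists 1 => x; rewrite indicE; case: (x \in A); rewrite /= ?normr1 ?normr0.
Qed.

Lemma Rint_indic (A : set T) : measurable A -> \int[P]_x \1_A x = fine (P A).
Proof. by move=> mA; rewrite /Rintegral integral_indic// setIT. Qed.

Lemma Rint_partition (I : finType) (xi : T -> I) (G : I -> R) :
  measurable_partition xi ->
  \int[P]_x G (xi x) = \sum_i fine (P (xi @^-1` [set i])) * G i.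
Proof.
move=> mxi.
transitivity (\int[P]_x (\sum_i G i * (\1_(xi @^-1` [set i]) x))).
  apply: eq_Rintegral => x _; rewrite (bigD1 (xi x))//= big1 ?addr0.
    by rewrite indicE mem_set//= mulr1.
  move=> i ix; rewrite indicE memNset ?mulr0// => /= e.
  by rewrite e eqxx in ix.
rewrite Rint_sum.
  apply: eq_bigr => i _; rewrite RintZ; last exact/bdd_mfun_indic/mxi.
  by rewrite mulrC Rint_indic.
by move=> i; apply: bdd_mfunZ; apply: bdd_mfun_indic; exact: mxi.
Qed.

Lemma sum_partition (I : finType) (xi : T -> I) : measurable_partition xi ->
  \sum_i fine (P (xi @^-1` [set i])) = 1.
Proof.
move=> mxi; rewrite -[RHS](Rint_cst 1).
rewrite (Rint_partition _ xi (fun=> 1))//; apply: eq_bigr => i _; by rewrite mulr1.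
Qed.

Lemma EFin_Rint f : bdd_mfun f -> (\int[P]_x (f x)%:E)%E = (\int[P]_x f x)%:E.
Proof.
move=> bf; rewrite /Rintegral fineK//; apply: integrable_fin_num => //.
exact: bdd_mfun_integrable.
Qed.

Variable S : T -> T.
Hypothesis mS : measurable_fun [set: T] S.

Lemma bdd_mfun_comp f : bdd_mfun f -> bdd_mfun (f \o S).
Proof.
move=> [mf [C fC]]; split; first exact: measurableT_comp.
by exists C => x; exact: fC.
Qed.

Lemma Rint_invariant f : Defs.invariant S P -> bdd_mfun f ->
  \int[P]_x f (S x) = \int[P]_x f x.
Proof.
move=> inv bf; congr fine.
have -> : (\int[P]_x (f (S x))%:E = \int[pushforward P S]_x (f x)%:E)%E.
  rewrite integral_pushforward//; first by apply/measurable_EFinP; case: bf.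
  by rewrite preimage_setT; apply: (bdd_mfun_integrable (f \o S)); exact: bdd_mfun_comp.
apply: eq_measure_integral => A mA _; exact: inv.
Qed.

Lemma bdd_mfun_iter n f : bdd_mfun f -> bdd_mfun (fun x => f (iter n S x)).
Proof.
elim: n f => // n IH f bf; apply: (IH (f \o S)); exact: bdd_mfun_comp.
Qed.

Lemma Rint_iter n f : Defs.invariant S P -> bdd_mfun f ->
  \int[P]_x f (iter n S x) = \int[P]_x f x.
Proof.
move=> inv; elim: n f => // n IH f bf.
rewrite (IH (f \o S)); last exact: bdd_mfun_comp.
exact: Rint_invariant.
Qed.

End BoundedIntegral.

Section FineProbability.
Context {d : measure_display} {T : measurableType d} {R : realType}.
Variable P : probability T R.
Implicit Types A B : set T.

Lemma measurable_setY A B : measurable A -> measurable B -> measurable (A `+` B).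
Proof. by move=> mA mB; rewrite setY_def; apply: measurableU; exact: measurableD. Qed.

Lemma le_fine_prob A B : measurable A -> measurable B -> A `<=` B ->
  fine (P A) <= fine (P B).
Proof.
move=> mA mB AB; apply: fine_le; rewrite ?fin_num_measure//.
by apply: le_measure; rewrite ?inE.
Qed.

Lemma fine_probU A B : measurable A -> measurable B ->
  fine (P (A `|` B)) <= fine (P A) + fine (P B).
Proof.
move=> mA mB; rewrite -fineD ?fin_num_measure//.
apply: fine_le; rewrite ?fin_numD ?fin_num_measure//; first exact: measurableU.
by rewrite measureU2.
Qed.

(** Continuity from above: the differences decrease to the empty set. *)
Lemma fine_prob_bigcup_tail (A : nat -> set T) (e : R) : (forall n, measurable (A n)) ->
  0 < e ->
  exists N, fine (P (\bigcup_n A n `\` \bigcup_(n < N) A n)) < e.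
Proof.
move=> mA e0; pose G n := \bigcup_n A n `\` \bigcup_(i < n) A i.
have mU : measurable (\bigcup_n A n) by exact: bigcupT_measurable.
have mG n : measurable (G n).
  by apply: measurableD => //; exact: bigcup_measurable.
have G0 : \bigcap_n G n = set0.
  rewrite -subset0 => x Gx; have [[i _ Aix] _] := Gx 0%N I.
  have [_ []] := Gx i.+1 I; exists i => //=.
have : (P \o G) x @[x --> \oo] --> 0%E.
  rewrite -(measure0 P) -G0; apply: nonincreasing_cvg_mu => //.
  - by rewrite -ge0_fin_numE// fin_num_measure.
  - exact: bigcapT_measurable.
  - move=> n m nm; apply/subsetPset => x [Ux nAx]; split => // -[i /= ilt Aix]; apply: nAx.
    by exists i => //=; exact: leq_trans ilt nm.
move=> /fine_cvgP[_ /cvgrPdist_lt/(_ _ e0)[N _ /(_ N (leqnn N))]] /=.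
rewrite sub0r normrN ger0_norm ?fine_ge0// => h; by exists N.
Qed.

End FineProbability.

Definition scons (a : 'I_3) (y : Sigma) : Sigma :=
  fun n => if n is m.+1 then y m else a.

Lemma measurable_shift (R : realType) :
  measurable_fun [set: BSigma] (sigma_shift : BSigma -> BSigma).
Proof.
apply: (measurability cylinders); first exact: measurable_cylinders R.
move=> _ [B BC <-]; rewrite setTI.
case: BC => [->|[n [y ->]]]; first by rewrite preimage_set0; exact: measurable0.
rewrite (_ : _ @^-1` _ = \bigcup_(a in [set: 'I_3]) cyl n.+1 (scons a y)).
  by apply: fin_bigcup_measurable => // a _; exact: measurable_cyl R _ _.
apply/seteqP; split => x /=.
  by move=> xy; exists (x 0%N) => // -[//|i] ilt /=; exact: xy.
by move=> [a _ xa] i ilt; exact: (xa i.+1).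
Qed.

Lemma continuous_bdd_mfun (R : realType) (f : Sigma -> R) :
  continuous f -> (exists C : R, forall x, `|f x| <= C) -> bdd_mfun (f : BSigma -> R).
Proof.
move=> cf bf; split => //.
apply: (measurability (@RGenOpens.G R)); first exact: RGenOpens.measurableE.
move=> _ [B [x [y ->]] <-]; rewrite setTI.
apply: sub_sigma_algebra.
apply: open_comp; last exact: interval_open.
by move=> z _; exact: cf.
Qed.

(** * Approximation of Borel sets by finitely many coordinates *)

Definition determined n (D : set BSigma) := forall x y, cyl n y x -> D x -> D y.

Lemma determined_le n m D : (n <= m)%N -> determined n D -> determined m D.
Proof. by move=> nm dD x y xy; apply: dD => i ilt; apply: xy; exact: leq_trans nm. Qed.

Lemma cyl_sym n x y : cyl n y x -> cyl n x y.
Proof. by move=> xy i ilt; rewrite xy. Qed.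

Lemma measurable_word (R : realType) n :
  measurable_partition (word n : BSigma -> {ffun 'I_n -> 'I_3}).
Proof.
move=> w; rewrite (_ : _ @^-1` _ = cyl n (unword n w)); first exact: measurable_cyl R _ _.
by apply/seteqP; split => x /=; rewrite word_cyl unwordK.
Qed.

Lemma measurable_determined (R : realType) n D : determined n D -> measurable D.
Proof.
move=> dD; rewrite (_ : D = \bigcup_(w in [set w | D (unword n w)]) (word n @^-1` [set w])).
  by apply: fin_bigcup_measurable => // w _; exact: measurable_word R _ _.
have e x : cyl n (unword n (word n x)) x by rewrite wordK.
apply/seteqP; split => x.
  by move=> Dx; exists (word n x) => //=; exact: dD (e x) Dx.
by move=> [w /= Dw xw]; apply: (dD _ _ _ Dw); apply: cyl_sym; rewrite -xw.
Qed.

(** The sets that can be approximated in measure form a sigma-algebra, and it contains the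
    cylinders. *)
Lemma determined_approx (R : realType) (P : probability BSigma R) (B : set BSigma) :
  measurable B -> forall e : R, 0 < e ->
  exists n D, determined n D /\ fine (P (B `+` D)) < e.
Proof.
rewrite (measurable_cylinders R).
pose G := [set B : set BSigma | measurable B /\ forall e : R, 0 < e ->
  exists n D, determined n D /\ fine (P (B `+` D)) < e].
suff : <<s cylinders >> `<=` G by move=> h /h[].
apply: smallest_sub.
- split.
  + split; first exact: measurable0.
    move=> e e0; exists 0%N, set0; split; first by move=> x y _ [].
    by rewrite setYK measure0.
  + move=> A [mA hA]; rewrite setTD; split; first exact: measurableC.
    move=> e /hA[n [D [dD De]]]; exists n, (~` D); split.
      by move=> x y /cyl_sym xy nDx Dy; apply: nDx; exact: dD Dy.
    by rewrite setY_def !setDE !setCK setUC setIC [~` A `&` _]setIC -!setDE -setY_def.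
  + move=> A hA; have mA n := (hA n).1; split; first exact: bigcupT_measurable.
    (* Half of [e] pays for the tail of the union; the other half is shared among the approximations
       of the first [N] sets. *)
    move=> e e0; have e20 : 0 < e / 2 by rewrite divr_gt0.
    have [N PN] := fine_prob_bigcup_tail P A (e / 2) mA e20.
    have eN : 0 < e / 2 / N.+1%:R by rewrite divr_gt0.
    have /choice[nn /choice[DD hD]] : forall i, exists n D, determined n D /\
      fine (P (A i `+` D)) < e / 2 / N.+1%:R by move=> i; exact: (hA i).2 _ eN.
    exists (\max_(i < N) nn i), (\bigcup_(i < N) DD i); split.
      move=> x y xy [i /= ilt Dix]; exists i => //=.
      apply: (determined_le _ _ _ _ (hD i).1) xy Dix.
      exact: (leq_bigmax_cond (Ordinal ilt)).
    have mD i : measurable (A i `+` DD i).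
      apply: measurable_setY => //; exact: measurable_determined R _ _ (hD i).1.
    have sub M : fine (P (\bigcup_(i < M) (A i `+` DD i))) <= M%:R * (e / 2 / N.+1%:R).
      elim: M => [|M IH]; first by rewrite bigcup_mkord big_ord0 measure0 mul0r.
      rewrite bigcup_mkord big_ord_recr/= -(bigcup_mkord M (fun i => A i `+` DD i)).
      apply: (le_trans (fine_probU _ _ _ _ _)) => //; first exact: bigcup_measurable.
      by rewrite -natr1 mulrDl mul1r lerD// ltW// (hD M).2.
    apply: (@le_lt_trans _ _ (fine (P ((\bigcup_n A n `\` \bigcup_(n < N) A n) `|`
       \bigcup_(i < N) (A i `+` DD i))))).
      apply: le_fine_prob.
      * apply: measurable_setY; first exact: bigcupT_measurable.
        by apply: bigcup_measurable => i _; exact: measurable_determined R _ _ (hD i).1.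
      * apply: measurableU; last exact: bigcup_measurable.
        by apply: measurableD; [exact: bigcupT_measurable|exact: bigcup_measurable].
      * move=> x [[[i _ Aix] nD]|[[i /= ilt Dix] nA]].
          have [[j jlt Ajx]|nAx] := pselect ((\bigcup_(n < N) A n) x).
            right; exists j => //; left; split => // Djx; apply: nD.
            by exists j.
          by left; split => //; exists i.
        right; exists i => //; right; split => // Aix; apply: nA; by exists i.
    apply: (le_lt_trans (fine_probU _ _ _ _ _)).
    * by apply: measurableD; [exact: bigcupT_measurable|exact: bigcup_measurable].
    * exact: bigcup_measurable.
    * rewrite [ltRHS](splitr e); apply: ltr_leD => //; apply: (le_trans (sub N)).
      rewrite mulrCA ger_pMr// ler_pdivrMr// mul1r ler_nat//.
- move=> A [->|[n [y ->]]]; (split; first by [exact: measurable0|exact: measurable_cyl R _ _]) => e e0.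
  + exists 0%N, set0; split; first by move=> x z _ [].
    by rewrite setYK measure0.
  + exists n, (cyl n y); split; last by rewrite setYK measure0.
    by move=> x z xz xy i ilt; rewrite -xz// xy.
Qed.

(** * Pressure bounds from positive supersolutions *)

Lemma ln_le_subr1 (R : realType) (x : R) : 0 < x -> ln x <= x - 1.
Proof. by move=> x0; rewrite -[in ln x](subrKC 1 x) le_ln1Dx// ltrBrDl subrr. Qed.

(** With [s] the sum of row [i], [ln t <= t - 1] at [t = Q i j / s] and [p i j <= s] bound each term
    by [Q i j - p i j]. The index [j] carries auxiliary information, here the symbols read, so the
    entropy of the marginal on [I] is reached directly. *)
Lemma gibbs_inequality (R : realType) (I J : finType) (p Q : I -> J -> R) :
  (forall i j, 0 <= p i j) -> (forall i j, 0 < Q i j) ->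
  \sum_i \sum_j Q i j <= \sum_i \sum_j p i j ->
  \sum_i \sum_j p i j * ln (Q i j) <=
  \sum_i (\sum_j p i j) * ln (\sum_j p i j).
Proof.
move=> p0 Q0 Qp; rewrite -subr_le0 -sumrB.
rewrite -subr_le0 in Qp; apply: le_trans Qp; rewrite -sumrB; apply: ler_sum => i _.
rewrite mulr_suml -!sumrB; apply: ler_sum => j _.
set s := \sum_j0 p i j0; have ps : p i j <= s.
  by rewrite /s (bigD1 j)//= lerDl sumr_ge0.
have [s0|s0] := ltP 0 s; last first.
  have -> : p i j = 0 by apply/eqP; rewrite eq_le p0 (le_trans ps).
  by rewrite !mul0r !subr0 ltW.
rewrite -mulrBr -ln_div ?posrE//; apply: (@le_trans _ _ (p i j * (Q i j / s - 1))).
  by rewrite ler_wpM2l// ln_le_subr1// divr_gt0.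
rewrite mulrBr mulr1 lerD2r mulrCA ger_pMr// ler_pdivrMr//; first by rewrite mul1r.
Qed.

Lemma ln_prod (R : realType) (I : Type) (r : seq I) (F : I -> R) :
  (forall i, 0 < F i) -> ln (\prod_(i <- r) F i) = \sum_(i <- r) ln (F i).
Proof.
move=> F0; suff [] : 0 < \prod_(i <- r) F i /\ ln (\prod_(i <- r) F i) = \sum_(i <- r) ln (F i) by [].
elim/big_ind2: _ => [|x x' y y' [x0 xx'] [y0 yy']|//]; first by rewrite ln1.
by rewrite lnM ?posrE// xx' yy' mulr_gt0.
Qed.

Definition birkhoff (R : realType) (psi : Sigma -> R) n (x : Sigma) : R :=
  \sum_(i < n) psi (iter i sigma_shift x).

Lemma iter_shift i (x : Sigma) n : iter i sigma_shift x n = x (n + i)%N.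
Proof.
elim: i n => [|i IH] n /=; first by rewrite addn0.
by rewrite {1}/sigma_shift IH addSnnS.
Qed.

Lemma birkhoffS (R : realType) (psi : Sigma -> R) n x :
  birkhoff R psi n.+1 x = psi x + birkhoff R psi n (sigma_shift x).
Proof.
rewrite /birkhoff big_ord_recl; congr (_ + _); apply: eq_bigr => i _.
by rewrite -iterSr.
Qed.

Lemma scons_shift x : scons (x 0%N) (sigma_shift x) = x.
Proof. by apply/funext => -[]. Qed.

Lemma shift_scons a x : sigma_shift (scons a x) = x.
Proof. by []. Qed.

Lemma unword_scons n (a : 'I_3) (w : {ffun 'I_n -> 'I_3}) :
  unword n.+1 (word n.+1 (scons a (unword n w))) = scons a (unword n w).
Proof.
apply/funext => i; have [ilt|ige] := ltnP i n.+1.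
  by rewrite (unwordE n.+1 _ (Ordinal ilt)) ffunE.
rewrite {1}/unword insubN -?leqNgt//; case: i ige => // i ige /=.
by rewrite /unword insubN -?leqNgt.
Qed.

Lemma sum_wordS (R : realType) n (F : Sigma -> R) :
  \sum_(w : {ffun 'I_n.+1 -> 'I_3}) F (unword n.+1 w) =
  \sum_(w : {ffun 'I_n -> 'I_3}) \sum_(a : 'I_3) F (scons a (unword n w)).
Proof.
rewrite pair_bigA/=.
rewrite (reindex (fun p : {ffun 'I_n -> 'I_3} * 'I_3 =>
   word n.+1 (scons p.2 (unword n p.1)))); last first.
  exists (fun w => (word n (sigma_shift (unword n.+1 w)), unword n.+1 w 0%N)) => [[w a] _|w _] /=.
    by rewrite unword_scons shift_scons unwordK.
  rewrite -[RHS](unwordK n.+1); apply/(word_cyl n.+1) => -[//|i] /= ilt.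
  rewrite (unwordE n _ (Ordinal (ilt : (i < n)%N))) ffunE//.
by apply: eq_bigr => -[w a] _ /=; rewrite unword_scons.
Qed.

Section PressureBound.
Context {R : realType}.
Variables (psi H : Sigma -> R) (lam : R).
Hypothesis lam0 : 0 < lam.
Hypothesis H_super : forall x,
  \sum_(a : 'I_3) expR (psi (scons a x)) * H (scons a x) <= lam * H x.

(** The sum is the [n]-th iterate of the transfer operator on [H], evaluated at [zeros] because
    [unword] pads words with 0s. *)
Lemma transfer_sum n :
  \sum_(w : {ffun 'I_n -> 'I_3}) expR (birkhoff R psi n (unword n w)) * H (unword n w)
  <= lam ^+ n * H zeros.
Proof.
elim: n => [|n IH].
  rewrite (big_pred1 (word 0 zeros)); last first.
    by move=> w /=; apply/esym/eqP/ffunP => -[].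
  rewrite /birkhoff big_ord0 expR0 expr0 (_ : unword _ _ = zeros)//.
  by apply/funext => i; rewrite /unword insubN.
rewrite (sum_wordS R n (fun x => expR (birkhoff R psi n.+1 x) * H x)).
apply: (@le_trans _ _ (\sum_(w : {ffun 'I_n -> 'I_3})
   lam * (expR (birkhoff R psi n (unword n w)) * H (unword n w)))).
  apply: ler_sum => w _.
  under eq_bigr do rewrite birkhoffS shift_scons expRD mulrAC mulrC.
  by rewrite -mulr_sumr mulrCA ler_wpM2l// expR_ge0.
by rewrite -mulr_sumr exprS -mulrA ler_wpM2l// ltW.
Qed.

Variable K : R.
Hypothesis psi_var : forall n x y, cyl n y x -> `|psi x - psi y| <= K / 2 ^+ n.

Lemma variation_continuous : continuous psi.
Proof.
have K0 : 0 <= K.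
  by have := psi_var 0 zeros zeros (fun _ _ => erefl); rewrite subrr normr0 expr0 divr1.
move=> x; apply/cvgrPdist_lt => e e0.
have e1 : 0 < e / (K + 1) by rewrite divr_gt0// ltr_wpDl.
have [n _ /(_ n (leqnn n)) ne] := near_infty_natSinv_expn_lt (PosNum e1).
apply/(nbhs_cyl R); exists n => y yx /=; rewrite distrC.
apply: (le_lt_trans (psi_var _ _ _ yx)).
have K1 : 0 < K + 1 by rewrite ltr_wpDl.
rewrite /= div1r ltr_pdivlMr// in ne; apply: le_lt_trans ne.
by rewrite mulrC ler_wpM2l ?invr_ge0 ?exprn_ge0// lerDl.
Qed.

Lemma variation_bdd_mfun : bdd_mfun (psi : BSigma -> R).
Proof.
apply: continuous_bdd_mfun; first exact: variation_continuous.
exists (`|psi zeros| + K) => x; rewrite -[psi x](subrK (psi zeros)) addrC.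
apply: (le_trans (ler_normD _ _)); rewrite lerD2l.
by have := psi_var 0 x zeros; rewrite expr0 divr1; apply => -[].
Qed.

(** The [i]-th terms differ by at most [K / 2 ^+ (n - i)], and these bounds add up to
    [K * (1 - 2 ^- n)]. *)
Lemma birkhoff_distortion n x y : cyl n y x ->
  `|birkhoff R psi n x - birkhoff R psi n y| <= K.
Proof.
have K0 : 0 <= K.
  by have := psi_var 0 zeros zeros (fun _ _ => erefl); rewrite subrr normr0 expr0 divr1.
move=> xy; suff : `|birkhoff R psi n x - birkhoff R psi n y| <= K * (1 - 2 ^- n).
  move=> h; apply: (le_trans h); by rewrite ler_piMr// lerBlDr lerDl invr_ge0 exprn_ge0.
elim: n x y xy => [|n IH] x y xy.
  by rewrite /birkhoff !big_ord0 subrr normr0 expr0 invr1 subrr mulr0.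
rewrite !birkhoffS opprD addrACA; apply: (le_trans (ler_normD _ _)).
have := psi_var _ _ _ xy; have /IH : cyl n (sigma_shift y) (sigma_shift x).
  by move=> i ilt; exact: (xy i.+1).
rewrite exprS invfM; set u := 2 ^- n; set a := `| _ |; set b := `| _ |.
by move=> ? ?; lra.
Qed.

Variable c : R.
Hypothesis H_gt0 : forall x, 0 < H x.
Hypothesis H_bound : forall x, `|ln (H x)| <= c.

Variable mu : probability BSigma R.
Hypothesis mu_inv : Defs.invariant (sigma_shift : BSigma -> BSigma) mu.

Let mS := measurable_shift R.

Lemma measurable_join (I : finType) (xi : BSigma -> I) n :
  measurable_partition xi ->
  measurable_partition (join_partition (sigma_shift : BSigma -> BSigma) xi n).
Proof.
move=> mxi f.
rewrite (_ : _ @^-1` _ = \bigcap_(i in [set: 'I_n]) (iter i sigma_shift @^-1` (xi @^-1` [set f i]))).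
  apply: fin_bigcap_measurable => // i _; rewrite -[X in measurable X]setTI.
  elim: (nat_of_ord i) (xi @^-1` _) (mxi (f i)) => [|k IH] A mA; first by rewrite setTI.
  rewrite (_ : _ @^-1` _ = iter k (sigma_shift : BSigma -> BSigma) @^-1` (sigma_shift @^-1` A)) //.
  by apply: IH; rewrite -[X in measurable X]setTI; exact: mS.
apply/seteqP; split => x /=.
  by move=> <- i _ /=; rewrite ffunE.
by move=> xf; apply/ffunP => i; rewrite ffunE; exact: xf.
Qed.


Variables (k : nat) (xi : BSigma -> 'I_k).
Hypothesis mxi : measurable_partition xi.

Section Guess.
Variables (m : nat) (J : Sigma -> 'I_k) (del : R).
Hypothesis J_det : forall x y, cyl m y x -> J x = J y.
Hypothesis del01 : 0 < del < 1.

(* The conditional probability of the cell [j] given the guess [j'], smoothed so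
   as to be positive. *)
Definition guess (j j' : 'I_k) : R := if j == j' then 1 - del else del / k%:R.

Lemma guess_gt0 j j' : 0 < guess j j'.
Proof.
have k0 : (0 < k)%N by case: k j j' => // -[].
have /andP[d0 d1] := del01.
by rewrite /guess; case: ifP => _; [rewrite subr_gt0|rewrite divr_gt0// ltr0n].
Qed.

Lemma sum_guess j' : \sum_j guess j j' <= 1.
Proof.
have k0 : (0 < k)%N by case: k j' => // -[].
have /andP[d0 d1] := del01.
rewrite (bigD1 j')//= {1}/guess eqxx.
rewrite (eq_bigr (fun=> del / k%:R)); last by move=> j /negbTE jj; rewrite /guess jj.
rewrite sumr_const -(mulr_natr (del / k%:R)) -lerBrDl subKr -mulrA ger_pMr//.
rewrite mulrC ler_pdivrMr ?ltr0n// mul1r ler_nat.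
by rewrite -[leqRHS]card_ord max_card.
Qed.

Let g x := ln (guess (xi x) (J x)).

Lemma bdd_mfun_guess : bdd_mfun (g : BSigma -> R).
Proof.
pose cc x := (xi x, word m x).
have mc : measurable_partition (cc : BSigma -> ('I_k * {ffun 'I_m -> 'I_3})%type).
  move=> [j w]; rewrite (_ : _ @^-1` _ = (xi @^-1` [set j]) `&` (word m @^-1` [set w])).
    by apply: measurableI; [exact: mxi|exact: measurable_word R _ _].
  by apply/seteqP; split => x /=; [move=> [-> ->]|move=> [<- <-]].
rewrite (_ : g = (fun p => ln (guess p.1 (J (unword m p.2)))) \o cc).
  exact: bdd_mfun_partition.
apply/funext => x; rewrite /g/=; congr (ln (guess _ _)).
by apply: J_det; rewrite wordK.
Qed.

(* Gibbs' inequality against the subprobability which draws the first [n + m]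
   symbols with the weights of the transfer operator, and then the cells from
   the guesses made on these symbols; it replaces the Kolmogorov-Sinai theorem. *)
Lemma shannon_join_le n :
  shannon mu (join_partition (sigma_shift : BSigma -> BSigma) xi n) <=
  (n + m)%:R * (ln lam - \int[mu]_x psi x) + (K + 2 * c) - n%:R * \int[mu]_x g x.
Proof.
set jn := join_partition _ _ _.
have mj : measurable_partition jn by exact: measurable_join.
(* The guess made at time [i < n] reads the [m] symbols from [i] on, so [n + m] symbols determine
   all the guesses. *)
pose N := (n + m)%N.
pose cc (x : BSigma) := (jn x, word N x).
have mcc : measurable_partition cc.
  move=> [a w]; rewrite (_ : _ @^-1` _ = (jn @^-1` [set a]) `&` (word N @^-1` [set w])).
    by apply: measurableI; [exact: mj|exact: measurable_word R _ _].
  by apply/seteqP; split => x /=; [move=> [-> ->]|move=> [<- <-]].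
pose p a w := fine (mu (cc @^-1` [set (a, w)])).
(* By [transfer_sum] these weights add up to at most 1; so do those of [Q], since the guesses have
   total at most 1 over the cells. *)
pose q (w : {ffun 'I_N -> 'I_3}) : R := expR (birkhoff R psi N (unword N w)) * H (unword N w)
  / (lam ^+ N * H zeros).
pose Q (a : {ffun 'I_n -> 'I_k}) (w : {ffun 'I_N -> 'I_3}) : R :=
  q w * \prod_(i < n) guess (a i) (J (iter i sigma_shift (unword N w))).
have q0 w : 0 < q w.
  by rewrite divr_gt0// mulr_gt0// ?expR_gt0// exprn_gt0.
have Pr0 (a : {ffun 'I_n -> 'I_k}) w :
    0 < \prod_(i < n) guess (a i) (J (iter i sigma_shift (unword N w))).
  by apply: prodr_gt0 => i _; exact: guess_gt0.
have Q0 a w : 0 < Q a w by rewrite mulr_gt0.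
have sumP : \sum_a \sum_w p a w = 1.
  by rewrite pair_bigA/= -(sum_partition mu _ cc)//; apply: eq_bigr => -[].
have sumQ : \sum_a \sum_w Q a w <= 1.
  rewrite exchange_big/=.
  apply: (@le_trans _ _ (\sum_w q w)).
    apply: ler_sum => w _; rewrite -mulr_sumr ler_piMr ?(ltW (q0 w))//.
    rewrite -(bigA_distr_bigA (fun i j => guess j (J (iter (nat_of_ord i) sigma_shift (unword N w))))).
    apply: prodr_ile1 => i _.
    by rewrite sum_guess andbT sumr_ge0// => j _; exact: ltW (guess_gt0 _ _).
  rewrite -mulr_suml ler_pdivrMr ?mul1r; first exact: transfer_sum.
  by rewrite mulr_gt0// exprn_gt0.
have sump a : \sum_w p a w = fine (mu (jn @^-1` [set a])).
  have e1 := Rint_partition mu _ jn (fun a' => (a' == a)%:R) mj.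
  have e2 := Rint_partition mu _ cc (fun p => (p.1 == a)%:R) mcc.
  have : \sum_(i : {ffun 'I_n -> 'I_k}) fine (mu (jn @^-1` [set i])) * (i == a)%:R =
      \sum_(i : {ffun 'I_n -> 'I_k} * {ffun 'I_N -> 'I_3}) fine (mu (cc @^-1` [set i])) * (i.1 == a)%:R.
    by rewrite -e1 -e2.
  rewrite (bigD1 a)//= eqxx mulr1 big1 ?addr0; last by move=> i /negbTE ->; rewrite mulr0.
  move=> ->; rewrite (eq_bigr (fun i => p i.1 i.2 * (i.1 == a)%:R)); last by move=> -[].
  rewrite -(pair_bigA _ (fun i j => p i j * (i == a)%:R))/=.
    rewrite (bigD1 a)//= [X in _ + X]big1 ?addr0.
      by apply: eq_bigr => w _; rewrite eqxx mulr1.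
    by move=> i /negbTE ia; rewrite big1// => w _; rewrite ia mulr0.
have := gibbs_inequality R _ _ p Q (fun a w => fine_ge0 (measure_ge0 mu _)) Q0.
rewrite sumP => /(_ sumQ).
under [X in _ <= X]eq_bigr do rewrite sump.
rewrite /shannon => Gibbs.
rewrite lerNl; apply: (le_trans _ Gibbs).
rewrite pair_bigA/=.
rewrite (eq_bigr (fun i => fine (mu (cc @^-1` [set i])) * ln (Q i.1 i.2))); last by move=> -[].
rewrite -(Rint_partition mu _ cc (fun i => ln (Q i.1 i.2)))//.
have bpsi := variation_bdd_mfun.
(* A pointwise lower bound for [ln Q]: replacing [x] by its padded word costs [K], and the two
   logarithms of [H] cost [c] each. *)
pose Phi (x : BSigma) : R := birkhoff R psi N x + \sum_(i < n) g (iter i sigma_shift x)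
   + (- N%:R * ln lam - (K + 2 * c)).
have bb : bdd_mfun (fun x : BSigma => birkhoff R psi N x).
  by apply: bdd_mfun_sum => i; exact: (bdd_mfun_iter _ mS).
have bg : bdd_mfun (fun x : BSigma => \sum_(i < n) g (iter i sigma_shift x)).
  by apply: bdd_mfun_sum => i; apply: (bdd_mfun_iter _ mS); exact: bdd_mfun_guess.
have -> : - (N%:R * (ln lam - \int[mu]_x psi x) + (K + 2 * c) - n%:R * \int[mu]_x g x)
   = \int[mu]_x Phi x.
  rewrite RintD//; [|exact: bdd_mfunD|exact: bdd_mfun_cst].
  rewrite RintD// Rint_cst /birkhoff.
  rewrite Rint_sum; last by move=> i; exact: (bdd_mfun_iter _ mS).
  rewrite Rint_sum; last by move=> i; apply: (bdd_mfun_iter _ mS); exact: bdd_mfun_guess.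
  under eq_bigr do rewrite (Rint_iter _ _ mS)//.
  rewrite [X in _ = _ + X + _](eq_bigr (fun=> \int[mu]_x g x)); last first.
    by move=> i _; apply: (Rint_iter _ _ mS) => //; exact: bdd_mfun_guess.
  rewrite !sumr_const !card_ord -[in RHS](mulr_natl (\int[mu]_x psi x)) -[in RHS](mulr_natl (\int[mu]_x g x)).
  by rewrite -/N; ring.
apply: le_Rint.
- by apply: bdd_mfunD; [exact: bdd_mfunD|exact: bdd_mfun_cst].
- by apply: (bdd_mfun_partition _ cc (fun i => ln (Q i.1 i.2))).
move=> x /=; set w := word N x.
have xw : cyl N x (unword N w) by rewrite -wordK.
rewrite /Q lnM ?posrE// /q ln_div ?posrE ?mulr_gt0 ?expR_gt0 ?exprn_gt0//.
rewrite !lnM ?posrE ?expR_gt0 ?exprn_gt0// expRK lnXn//.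
rewrite ln_prod; last by move=> i; exact: guess_gt0.
have -> : \sum_(i < n) ln (guess (jn x i) (J (iter i sigma_shift (unword N w)))) =
    \sum_(i < n) g (iter i sigma_shift x).
  apply: eq_bigr => i _; rewrite /g ffunE; congr (ln (guess _ _)).
  apply: J_det => l lm; rewrite !iter_shift.
  by apply: xw; rewrite /N (addnC n) -addSn leq_add// ltnW.
have /ler_normlP[h1 _] := birkhoff_distortion N _ _ xw.
have /ler_normlP[h2 _] := H_bound (unword N w).
have /ler_normlP[_ h3] := H_bound zeros.
rewrite /Phi -[in leRHS](mulr_natl (ln lam)).
set NR := N%:R; lra.
Qed.

End Guess.

(** Each cell is close in measure to a set determined by finitely many symbols; guessing with these
    sets fails only on the symmetric differences. *)
Lemma good_guess (e : R) : 0 < e -> exists m (J : Sigma -> 'I_k) del,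
  [/\ forall x y, cyl m y x -> J x = J y, 0 < del < 1 &
      - e <= \int[mu]_x ln (guess del (xi x) (J x))].
Proof.
move=> e0.
have k0 : (0 < k)%N by case: k xi => // xi0; case: (xi0 zeros).
have kR : 0 < k%:R :> R by rewrite ltr0n.
(* A correct guess then costs exactly [- ln (1 - del) = e / 2]. *)
pose del : R := 1 - expR (- (e / 2)).
have del01 : 0 < del < 1.
  rewrite /del subr_gt0 ltrBlDr ltrDl expR_gt0 andbT -expR0 ltr_expR.
  by rewrite oppr_lt0 divr_gt0.
have /andP[d0 d1] := del01.
have l0 : ln (del / k%:R) < 0.
  rewrite ln_lt0// divr_gt0//= ltr_pdivrMr// mul1r (lt_le_trans d1)//.
  by rewrite ler1n.
(* The [k] symmetric differences, at the price [- ln (del / k%:R)] each, then cost at most [e / 2]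
   in total. *)
pose e' := e / 2 / - ln (del / k%:R) / k%:R.
have e'0 : 0 < e' by rewrite !divr_gt0// oppr_gt0.
have /choice[nn /choice[DD hD]] : forall j : 'I_k, exists n D, determined n D /\
    fine (mu ((xi @^-1` [set j]) `+` D)) < e'.
  by move=> j; apply: determined_approx => //; exact: mxi.
pose J x := if [pick j | `[< DD j x >]] is Some j then j else xi zeros.
pose m := \max_(j < k) nn j.
have J_det x y : cyl m y x -> J x = J y.
  move=> xy; rewrite /J; congr (if _ is Some j then j else _).
  apply: eq_pick => j; apply: asbool_equiv_eq.
  have dj : determined m (DD j) by apply: (determined_le (nn j)); [exact: leq_bigmax|exact: (hD j).1].
  by split; apply: dj => //; exact: cyl_sym.
exists m, J, del; split => //.
pose B j := (xi @^-1` [set j]) `+` DD j.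
have mB j : measurable (B j).
  apply: measurable_setY; first exact: mxi.
  exact: measurable_determined R _ _ (hD j).1.
apply: (@le_trans _ _ (\int[mu]_x (ln (1 - del) + ln (del / k%:R) * \sum_j \1_(B j) x))).
  rewrite RintD; [|exact: bdd_mfun_cst|]; last first.
    by apply: bdd_mfunZ; apply: bdd_mfun_sum => j; exact: bdd_mfun_indic.
  rewrite Rint_cst RintZ; last by apply: bdd_mfun_sum => j; exact: bdd_mfun_indic.
  rewrite Rint_sum; last by move=> j; exact: bdd_mfun_indic.
  have -> : ln (1 - del) = - (e / 2) by rewrite /del subKr expRK.
  rewrite [in leLHS](splitr e) opprD lerD2l.
  apply: (@le_trans _ _ (ln (del / k%:R) * (k%:R * e'))).
    rewrite /e' le_eqVlt; apply/orP; left; apply/eqP; field.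
    by rewrite gt_eqF//= lt_eqF.
  apply: ler_wnM2l; first exact: ltW.
  rewrite mulr_natl -[X in _ *+ X]card_ord -sumr_const; apply: ler_sum => j _.
  by rewrite Rint_indic// ltW// (hD j).2.
apply: le_Rint; [|exact: (bdd_mfun_guess m)|].
  apply: bdd_mfunD; first exact: bdd_mfun_cst.
  by apply: bdd_mfunZ; apply: bdd_mfun_sum => j; exact: bdd_mfun_indic.
move=> x; have S0 : 0 <= \sum_j (\1_(B j) x : R).
  by apply: sumr_ge0 => j _; rewrite indicE.
have [xJ|xJ] := eqVneq (xi x) (J x).
  rewrite /guess xJ eqxx gerDl mulr_le0_ge0// ltW//.
(* Off all the symmetric differences, [x] lies in [DD j] for [j = xi x] only, so [pick] would have
   returned [xi x]. *)
have [j Bjx] : exists j, B j x.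
  apply: contrapT => nB; move/eqP: xJ; apply.
  have DxP j : DD j x <-> xi x = j.
    have nBj : ~ B j x by move=> Bjx; apply: nB; exists j.
    split=> [Dx|xj]; apply: contrapT => n; apply: nBj; [by right|by left].
  rewrite /J; case: pickP => [j /asboolP/DxP//|/(_ (xi x))/asboolP].
  by move=> n; exfalso; apply: n; exact/DxP.
rewrite /guess (negbTE xJ); apply: (@le_trans _ _ (ln (del / k%:R) * 1)); last by rewrite mulr1.
have S1 : 1 <= \sum_j (\1_(B j) x : R).
  rewrite (bigD1 j)//= indicE mem_set// lerDl.
  by apply: sumr_ge0 => i _; rewrite indicE.
have : ln (1 - del) <= 0 by rewrite ltW// ln_lt0// subr_gt0 d1/= ltrBlDr ltrDl.
have := ler_wnM2l (ltW l0) S1; lra.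
Qed.

Lemma shannon_ge0 (I : finType) (eta : BSigma -> I) : measurable_partition eta ->
  0 <= shannon mu eta.
Proof.
move=> meta; rewrite /shannon oppr_ge0; apply: sumr_le0 => i _.
apply: mulr_ge0_le0; first exact: fine_ge0.
apply: ln_le0; rewrite -[leRHS]/(fine 1%E); apply: fine_le => //; rewrite ?fin_num_measure ?probability_le1//; exact: meta.
Qed.

(** For a fixed guess, dividing [shannon_join_le] by [n] makes the constants and the [m] extra
    symbols negligible. An eventual lower bound [l] covers both uses: just below the limit when the
    rates converge, and 0 otherwise. *)
Lemma entropy_rate_le (l : R) :
  (\forall n \near \oo,
     l <= shannon mu (join_partition (sigma_shift : BSigma -> BSigma) xi n) / n%:R) ->
  l <= ln lam - \int[mu]_x psi x.
Proof.
move=> hl; apply/ler_addgt0Pr => e e0.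
have e20 : 0 < e / 2 by rewrite divr_gt0.
have [m [J [del [J_det del01 hg]]]] := good_guess _ e20.
set A := ln lam - _.
pose C := m%:R * A + (K + 2 * c).
have [n [n0 Cn ln]] : exists n, [/\ (0 < n)%N, C / (e / 2) < n%:R :> R & l <=
   shannon mu (join_partition (sigma_shift : BSigma -> BSigma) xi n) / n%:R].
  near \oo => n; exists n; split; first by near: n; exact: nbhs_infty_gt.
    by near: n; exact: nbhs_infty_gtr.
  by near: n.
have nR : 0 < n%:R :> R by rewrite ltr0n.
rewrite ler_pdivlMr// in ln; rewrite ltr_pdivrMr// in Cn.
have := shannon_join_le _ _ _ J_det del01 n; rewrite -/A natrD.
move: hg Cn; rewrite /C; set G := Rintegral _ _ _ => hg Cn hs.
rewrite -(ler_pM2r nR).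
have := ler_wpM2r (ltW nR) hg; lra.
Unshelve. all: by end_near.
Qed.

Lemma partition_entropy_le :
  partition_entropy (sigma_shift : BSigma -> BSigma) mu xi <= ln lam - \int[mu]_x psi x.
Proof.
rewrite /partition_entropy; set u := (fun n => _).
have [cu|/dvgP ->] := pselect (cvgn u); last first.
  (* [limn] is 0 on a divergent sequence. *)
  apply: entropy_rate_le; near=> n; apply: divr_ge0 => //; apply: shannon_ge0.
  exact: measurable_join.
apply/ler_addgt0Pl => e e0; rewrite -lerBlDl.
apply: entropy_rate_le; move/cvgrPdist_lt : cu => /(_ _ e0); apply: filterS => n.
by move=> /ltr_normlP[_]; rewrite -/(u n); lra.
Unshelve. all: by end_near.
Qed.

End PressureBound.

Lemma KS_entropy_le (R : realType) (psi H : Sigma -> R) (lam K c : R)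
    (mu : probability BSigma R) :
  0 < lam ->
  (forall x, \sum_(a : 'I_3) expR (psi (scons a x)) * H (scons a x) <= lam * H x) ->
  (forall n x y, cyl n y x -> `|psi x - psi y| <= K / 2 ^+ n) ->
  (forall x, 0 < H x) -> (forall x, `|ln (H x)| <= c) ->
  Defs.invariant (sigma_shift : BSigma -> BSigma) mu ->
  (KS_entropy (sigma_shift : BSigma -> BSigma) mu <= (ln lam - \int[mu]_x psi x)%:E)%E.
Proof.
move=> lam0 Hs psiv H0 Hb inv; apply: ge_ereal_sup => _ [k [xi [mxi ->]]].
by rewrite lee_fin; exact: (partition_entropy_le psi H lam lam0 Hs K psiv c H0 Hb).
Qed.

(** * Markov measures *)

Definition o0 : 'I_3 := Ordinal (isT : (0 < 3)%N).
Definition o1 : 'I_3 := Ordinal (isT : (1 < 3)%N).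
Definition o2 : 'I_3 := Ordinal (isT : (2 < 3)%N).

Lemma ord3P (a : 'I_3) : [\/ a = o0, a = o1 | a = o2].
Proof.
by case: a => -[|[|[|//]]] lt; [apply: Or31|apply: Or32|apply: Or33]; exact: val_inj.
Qed.

Lemma sum_ord3 (R : realType) (F : 'I_3 -> R) : \sum_a F a = F o0 + F o1 + F o2.
Proof.
rewrite !big_ord_recl big_ord0 addr0 addrA.
by congr (F _ + F _ + F _); exact: val_inj.
Qed.

Lemma unit_interval_probability (R : realType) :
  exists P : probability (measurableTypeR R) R,
    forall A, P A = lebesgue_measure (A `&` [set` `[0, 1[]).
Proof.
pose I01 : set R := [set` `[0, 1[].
have mI : measurable I01 by exact: measurable_itv.
pose lam : {measure set (measurableTypeR R) -> \bar R} := mrestr (@lebesgue_measure R) mI.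
have lam1 : lam setT = 1%E.
  by rewrite /lam /= /mrestr setTI lebesgue_measure_itv /= lte_fin ltr01 oppr0 adde0.
pose P : probability (measurableTypeR R) R := HB.pack (Measure.sort lam)
  (Measure_isProbability.Build _ _ _ (Measure.sort lam) lam1).
by exists P.
Qed.

Section Markov.
Context {R : realType}.

Fixpoint cylinder_weight (M : 'I_3 -> 'I_3 -> R) (r : 'I_3 -> R) n (y : Sigma) : R :=
  if n is n'.+1 then r (y 0%N) * cylinder_weight M (M (y 0%N)) n' (sigma_shift y) else 1.

Definition stochastic (r : 'I_3 -> R) := (forall a, 0 <= r a) /\ \sum_a r a = 1.

Variable M : 'I_3 -> 'I_3 -> R.
Hypothesis M_stoch : forall a, stochastic (M a).

Definition low (r : 'I_3 -> R) (a : 'I_3) : R :=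
  match nat_of_ord a with 0 => 0 | 1 => r o0 | _ => r o0 + r o1 end.

Definition digit (r : 'I_3 -> R) (u : R) : 'I_3 :=
  if u < r o0 then o0 else if u < r o0 + r o1 then o1 else o2.

(* The itinerary of [u] in [[0, 1[] under the piecewise affine map which first
   maps intervals of lengths [r a] onto [[0, 1[], and then, after the digit [a],
   intervals of lengths [M a b]. *)
Fixpoint code (r : 'I_3 -> R) (u : R) (n : nat) : 'I_3 :=
  if n is n'.+1 then code (M (digit r u)) ((u - low r (digit r u)) / r (digit r u)) n'
  else digit r u.

Lemma digitP r u a : stochastic r -> 0 <= u < 1 ->
  digit r u = a <-> low r a <= u < low r a + r a.
Proof.
move=> [r0]; rewrite sum_ord3 => r1 /andP[u0 u1].
have := r0 o0; have := r0 o1; have := r0 o2.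
rewrite /digit => p2 p1 p0.
have E (b c : 'I_3) (B : bool) : b = c -> B -> (b = c <-> B) by move=> -> ->.
have NE (b c : 'I_3) (B : bool) : val b != val c -> ~ B -> (b = c <-> B).
  by move=> /eqP nbc nB; split=> [/(congr1 val)|].
case: ltP => h0; [|case: ltP => h1]; case: (ord3P a) => ->; rewrite /low/=;
  solve [apply: E => //; apply/andP; split; lra | apply: NE => // /andP[? ?]; lra].
Qed.

(** After the first digit [a], the affine map carries the interval of [a] onto [[0, 1[], where
    induction applies with the row [M a]; the length is scaled by [r a]. *)
Lemma code_interval n r y : stochastic r ->
  exists l, [/\ 0 <= l, l + cylinder_weight M r n y <= 1, 0 <= cylinder_weight M r n y &
   forall u, 0 <= u < 1 -> cyl n y (code r u) <-> l <= u < l + cylinder_weight M r n y].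
Proof.
elim: n r y => [|n IH] r y rs /=.
  by exists 0; rewrite add0r; split => // u u01; split => // _ i.
set a := y 0%N; have [l [l0 l1 w0 lP]] := IH (M a) (sigma_shift y) (M_stoch a).
set w := cylinder_weight _ _ _ _ in l1 w0 lP *.
have low0 : 0 <= low r a /\ low r a + r a <= 1.
  have := rs.2; rewrite sum_ord3 /low; have [h _] := rs.
  have := h o0; have := h o1; have := h o2.
  by case: (ord3P a) => -> /= ? ? ? ?; split; lra.
have ra0 := rs.1 a.
exists (low r a + r a * l); split.
- by rewrite addr_ge0 ?mulr_ge0//; exact: low0.1.
- apply: le_trans low0.2; rewrite -addrA lerD2l -mulrDr ler_piMr//.
- by rewrite mulr_ge0.
- move=> u u01.
  have codeS : cyl n.+1 y (code r u) <-> digit r u = a /\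
      cyl n (sigma_shift y) (code (M (digit r u)) ((u - low r (digit r u)) / r (digit r u))).
    split=> [h|[h1 h2]].
      by split; [exact: (h 0%N)|move=> i ilt; exact: (h i.+1)].
    by move=> [|i] ilt //=; exact: h2.
  (* A digit of weight 0 has an empty interval: both sides are false, and the division by [r a] does
     not matter. *)
  rewrite codeS; have [ra|ra] := eqVneq (r a) 0.
    by split=> [[/(digitP _ _ _ rs u01) + _]|]; rewrite ra ?mul0r ?addr0 => /andP[? ?]; exfalso; lra.
  have rapos : 0 < r a by rewrite lt_neqAle eq_sym ra.
  split=> [[da]|/andP[lu ul]].
    rewrite da; have /andP[h1 h2] := (digitP _ _ _ rs u01).1 da.
    have v01 : 0 <= (u - low r a) / r a < 1.
      by rewrite divr_ge0 ?subr_ge0//= ltr_pdivrMr// mul1r ltrBlDl.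
    move=> /(lP _ v01) /andP[]; rewrite ler_pdivlMr// ltr_pdivrMr// => ? ?.
    apply/andP; split; lra.
  have rl : 0 <= r a * l by rewrite mulr_ge0.
  have rlw : r a * (l + w) <= r a by rewrite ler_piMr.
  have da : digit r u = a.
    by apply/(digitP _ _ _ rs u01)/andP; split; rewrite mulrDr in rlw; lra.
  split => //; rewrite da.
  have v01 : 0 <= (u - low r a) / r a < 1.
    rewrite divr_ge0 ?subr_ge0//=; last by lra.
    by rewrite ltr_pdivrMr// mul1r; rewrite mulrDr in rlw; lra.
  by apply/(lP _ v01)/andP; rewrite ler_pdivlMr// ltr_pdivrMr//; split; lra.
Qed.

Lemma measurable_digit r a : measurable (digit r @^-1` [set a]).
Proof.
pose A c := [set u : R | u < c].
have mA c : measurable (A c).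
  rewrite (_ : A c = [set` `]-oo, c[]); last by apply/seteqP; split => u /=; rewrite in_itv.
  exact: measurable_itv.
rewrite (_ : _ @^-1` _ = if a == o0 then A (r o0) else if a == o1 then
   A (r o0 + r o1) `\` A (r o0) else ~` A (r o0) `\` A (r o0 + r o1)).
  case: ifP => _ //; case: ifP => _; first exact: measurableD.
  by apply: measurableD => //; exact: measurableC.
apply/seteqP; split => u /=; rewrite /digit /A; case: (ord3P a) => -> /=;
  case: (ltP u (r o0)) => h0; case: (ltP u (r o0 + r o1)) => h1;
  solve [by []|by move/(congr1 val)|by move=> _; split => //; apply/negP; rewrite -leNgt
        |by move=> /= [/negP]; rewrite -?leNgt ?ltNge ?h0 ?h1
        |by move=> /=; lra|by move=> /= []; lra].
Qed.

Lemma measurable_code_coord n r a : measurable [set u | code r u n = a].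
Proof.
elim: n r a => [|n IH] r a; first exact: measurable_digit.
rewrite (_ : [set u | _] = \bigcup_(b in [set: 'I_3]) ((digit r @^-1` [set b]) `&`
   ((fun u => (u - low r b) / r b) @^-1` [set u | code (M b) u n = a]))).
  apply: fin_bigcup_measurable => // b _; apply: measurableI; first exact: measurable_digit.
  have mf : measurable_fun [set: R] (fun u => (u - low r b) / r b).
    by apply: measurable_funM => //; exact: measurable_funB.
  by rewrite -[X in measurable X]setTI; exact: (mf measurableT _ (IH (M b) a)).
apply/seteqP; split => u /=.
  by move=> h; exists (digit r u).
by move=> [b _ [/= -> h]].
Qed.

Lemma measurable_code r : measurable_fun [set: measurableTypeR R] (code r : measurableTypeR R -> BSigma).
Proof.
apply: (measurability cylinders); first exact: measurable_cylinders R.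
move=> _ [B BC <-]; rewrite setTI.
case: BC => [->|[n [y ->]]]; first by rewrite preimage_set0; exact: measurable0.
rewrite (_ : _ @^-1` _ = \bigcap_(i in [set i | (i < n)%N]) [set u | code r u i = y i]).
  by apply: bigcap_measurableType => i _; exact: measurable_code_coord.
by apply/seteqP; split => u h i; exact: h.
Qed.

Variable pi : 'I_3 -> R.
Hypothesis pi_stoch : stochastic pi.
Hypothesis pi_stat : forall b, \sum_a pi a * M a b = pi b.

(** This is shift invariance on cylinders; the pi-system argument in [markov_exists] extends it to
    Borel sets. *)
Lemma weight_stationary n y :
  \sum_a cylinder_weight M pi n.+1 (scons a y) = cylinder_weight M pi n y.
Proof.
rewrite /= ; under eq_bigr do rewrite shift_scons.
case: n => [|n] /=; first by under eq_bigr do rewrite mulr1; exact: pi_stoch.2.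
under eq_bigr do rewrite mulrA.
by rewrite -mulr_suml pi_stat.
Qed.

Lemma markov_exists : exists nu : probability BSigma R,
  Defs.invariant (sigma_shift : BSigma -> BSigma) nu /\
  forall n y, nu (cyl n y) = (cylinder_weight M pi n y)%:E.
Proof.
have [P PE] := unit_interval_probability R.
pose cf : {mfun (measurableTypeR R) >-> BSigma} :=
  MeasurableFun.Pack (MeasurableFun.Class (isMeasurableFun.Build _ _ _ _ _ (measurable_code pi))).
pose nu : probability BSigma R := distribution P cf.
have nucyl n y : nu (cyl n y) = (cylinder_weight M pi n y)%:E.
  have [l [l0 l1 w0 lP]] := code_interval n pi y pi_stoch.
  rewrite /nu /= /distribution /pushforward /= PE.
  rewrite (_ : _ `&` _ = [set` `[l, l + cylinder_weight M pi n y[]).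
    rewrite lebesgue_measure_itv /= lte_fin ltrDl; case: ifPn => h.
      by rewrite -EFinB addrAC subrr add0r.
    by congr EFin; apply/eqP; rewrite eq_le w0/= leNgt.
  apply/seteqP; split => u /=.
    move=> [h]; rewrite /= !in_itv/= => u01; exact/lP.
  rewrite /= !in_itv/= => h.
  have u01 : 0 <= u < 1.
    by move/andP: h => [h1 h2]; rewrite (le_trans l0 h1) (lt_le_trans h2 l1).
  by split => //; exact/lP.
exists nu; split; last exact: nucyl.
pose sf : {mfun BSigma >-> BSigma} :=
  MeasurableFun.Pack (MeasurableFun.Class (isMeasurableFun.Build _ _ _ _ _ (measurable_shift R))).
have T0 : setT = cyl 0 zeros by apply/seteqP; split.
suff : forall B, measurable B -> (distribution nu sf) B = nu B by [].
move=> B mB; apply: (measure_unique cylinders (fun=> setT)) => //.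
- exact: measurable_cylinders R.
- exact: setI_closed_cylinders.
- by move=> _; right; exists 0%N, zeros.
- by rewrite bigcup_const//; exists 0%N.
- move=> A [->|[n [y ->]]]; first by rewrite !measure0.
  have e : (sigma_shift : BSigma -> BSigma) @^-1` cyl n y =
      \big[setU/set0]_(a < 3) cyl n.+1 (scons a y).
    rewrite -bigcup_seq; apply/seteqP; split => x /=.
      move=> xy; exists (x 0%N); first by rewrite /= mem_index_enum.
      by move=> -[//|i] ilt /=; exact: xy.
    by move=> [a _ xa] i ilt; exact: (xa i.+1).
  transitivity (nu (\big[setU/set0]_(a < 3) cyl n.+1 (scons a y))); first by rewrite -e.
  transitivity (\sum_(a < 3) nu (cyl n.+1 (scons a y)))%E.
    have mF a : measurable (cyl n.+1 (scons a y)) by exact: measurable_cyl R _ _.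
    have tF : trivIset setT (fun a => cyl n.+1 (scons a y)).
      apply/trivIsetP => a b _ _ ab; apply/seteqP; split => // x [xa xb].
      by move/eqP: ab; apply; exact: (etrans (esym (xa 0%N isT)) (xb 0%N isT)).
    have h := measure_bigsetU_ord nu predT mF tF.
    exact: h.
  transitivity ((cylinder_weight M pi n y)%:E); last exact: esym (nucyl n y).
  rewrite -weight_stationary -sumEFin; apply: eq_bigr => a _; exact: nucyl.
- move=> _; apply: (@le_lt_trans _ _ 1%E); last exact: ltry.
  by rewrite -(probability_setT (distribution nu sf)).
Qed.

End Markov.

(** * Entropy of a Markov measure *)

Section MarkovEntropy.
Context {R : realType}.
Variables (M : 'I_3 -> 'I_3 -> R) (pi : 'I_3 -> R).
Hypothesis M_stoch : forall a, stochastic (M a).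
Hypothesis pi_stoch : stochastic pi.
Variable nu : probability BSigma R.
Hypothesis nu_inv : Defs.invariant (sigma_shift : BSigma -> BSigma) nu.
Hypothesis nu_cyl : forall n y, nu (cyl n y) = (cylinder_weight M pi n y)%:E.

Let mS := measurable_shift R.

Lemma weight_ge0 n r y : (forall a, 0 <= r a) -> 0 <= cylinder_weight M r n y.
Proof.
elim: n r y => //= n IH r y r0; rewrite mulr_ge0//; apply: IH.
exact: (M_stoch _).1.
Qed.

(** The factor [p] keeps the identity true when some transition has probability 0: both sides vanish
    there, although [ln] with [ln 0 = 0] is not multiplicative. *)
Lemma weight_ln n r (y : Sigma) : (forall a, 0 <= r a) ->
  let p := cylinder_weight M r n.+1 y in
  p * ln p = p * (ln (r (y 0%N)) + \sum_(i < n) ln (M (y i) (y i.+1))).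
Proof.
elim: n r y => [|n IH] r y r0 p; first by rewrite /p /= mulr1 big_ord0 addr0.
rewrite /p; set w := cylinder_weight M (M (y 0%N)) n.+1 (sigma_shift y).
have -> : cylinder_weight M r n.+2 y = r (y 0%N) * w by [].
have w0 : 0 <= w by apply: weight_ge0; exact: (M_stoch _).1.
have := IH (M (y 0%N)) (sigma_shift y) (M_stoch _).1; rewrite -/w /= => IHw.
have [->|rn] := eqVneq (r (y 0%N)) 0; first by rewrite !mul0r.
have [->|wn] := eqVneq w 0; first by rewrite mulr0 !mul0r.
have rp : 0 < r (y 0%N) by rewrite lt_neqAle eq_sym rn r0.
have wp : 0 < w by rewrite lt_neqAle eq_sym wn w0.
rewrite lnM ?posrE//; congr (_ * (_ + _)).
by move/(mulfI wn): IHw => ->; rewrite big_ord_recl.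
Qed.

Let coord (x : BSigma) : 'I_3 := x 0%N.

Lemma join_coord n x :
  join_partition (sigma_shift : BSigma -> BSigma) coord n x = word n x.
Proof. by apply/ffunP => i; rewrite !ffunE /coord (iter_shift i x). Qed.

Let two (x : BSigma) : 'I_3 * 'I_3 := (x 0%N, x 1%N).

Lemma preimage_two a b : two @^-1` [set (a, b)] = cyl 2 (scons a (scons b zeros)).
Proof.
apply/seteqP; split => x /=.
  by move=> [xa xb] [|[|//]] _.
by move=> h; rewrite /two (h 0%N)// (h 1%N).
Qed.

Lemma measurable_two : measurable_partition two.
Proof. by move=> [a b]; rewrite preimage_two; exact: measurable_cyl R _ _. Qed.

Lemma bdd_mfun_two (G : 'I_3 -> 'I_3 -> R) :
  bdd_mfun (fun x : BSigma => G (x 0%N) (x 1%N)).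
Proof. exact: (bdd_mfun_partition _ two (fun p => G p.1 p.2) measurable_two). Qed.

Lemma Rint_two (G : 'I_3 -> 'I_3 -> R) :
  \int[nu]_x G (x 0%N) (x 1%N) = \sum_a \sum_b pi a * M a b * G a b.
Proof.
rewrite (Rint_partition nu _ two (fun p => G p.1 p.2) measurable_two).
rewrite pair_bigA/=; apply: eq_bigr => -[a b] _ /=.
by rewrite preimage_two nu_cyl/= mulr1.
Qed.

Let g (x : BSigma) : R := ln (M (x 0%N) (x 1%N)).

Lemma shannon_markov n :
  shannon nu (join_partition (sigma_shift : BSigma -> BSigma) coord n.+1) =
  - (\int[nu]_x ln (pi (x 0%N))) - n%:R * \int[nu]_x g x.
Proof.
rewrite /shannon -opprD; congr (- _).
pose F (y : Sigma) : R := ln (pi (y 0%N)) + \sum_(i < n) ln (M (y i) (y i.+1)).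
transitivity (\int[nu]_x F (unword n.+1 (word n.+1 x))).
  rewrite (Rint_partition nu _ (word n.+1) (fun w => F (unword n.+1 w)))//; last exact: measurable_word R _.
  apply: eq_bigr => w _.
  have -> : join_partition (sigma_shift : BSigma -> BSigma) coord n.+1 @^-1` [set w] = cyl n.+1 (unword n.+1 w).
    by apply/seteqP; split => x /=; rewrite join_coord word_cyl unwordK.
  have -> : word n.+1 @^-1` [set w] = cyl n.+1 (unword n.+1 w).
    by apply/seteqP; split => x /=; rewrite word_cyl unwordK.
  by rewrite nu_cyl /fine weight_ln//; exact: pi_stoch.1.
have bg : bdd_mfun g by exact: (bdd_mfun_two (fun a b => ln (M a b))).
transitivity (\int[nu]_x (ln (pi (x 0%N)) + \sum_(i < n) g (iter i sigma_shift x))).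
  apply: eq_Rintegral => x _; rewrite /F.
  have e i : (i < n.+1)%N -> unword n.+1 (word n.+1 x) i = x i.
    by move=> ilt; rewrite (unwordE n.+1 _ (Ordinal ilt)) ffunE.
  rewrite e//; congr (_ + _); apply: eq_bigr => i _.
  rewrite !e ?ltnS//; last by rewrite ltnW.
  by rewrite /g !(iter_shift i x).
rewrite RintD.
- rewrite Rint_sum; last by move=> i; exact: (bdd_mfun_iter _ mS).
  rewrite (eq_bigr (fun=> \int[nu]_x g x)); last first.
    by move=> i _; exact: (Rint_iter _ _ mS).
  by rewrite sumr_const card_ord mulr_natl.
- exact: (bdd_mfun_two (fun a _ => ln (pi a))).
- by apply: bdd_mfun_sum => i; exact: (bdd_mfun_iter _ mS).
Qed.

(** The partition by the first symbol already has this entropy rate, with an exact correction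
    proportional to [harmonic n]. *)
Lemma markov_entropy :
  ((- \sum_a \sum_b pi a * M a b * ln (M a b))%:E <=
   KS_entropy (sigma_shift : BSigma -> BSigma) nu)%E.
Proof.
rewrite -(Rint_two (fun a b => ln (M a b))); apply: ereal_sup_ubound.
exists 3%N, coord; split.
  move=> a; rewrite (_ : _ @^-1` _ = cyl 1 (scons a zeros)); first exact: measurable_cyl R _ _.
  by apply/seteqP; split => x /=; [move=> h [|//] _|move=> h; rewrite /coord (h 0%N)].
congr EFin; apply/esym; rewrite /partition_entropy.
set G := \int[nu]_x _; set c0 := \int[nu]_x ln (pi (x 0%N)).
apply: cvg_lim => //; rewrite -cvg_shiftS.
rewrite (_ : (fun n => _) = (fun n => - G + (G - c0) * harmonic n)); last first.
  apply/funext => n; rewrite shannon_markov -/G -/c0 /harmonic/=.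
  by rewrite -natr1; field; rewrite natr1 pnatr_eq0.
have : - G + (G - c0) * harmonic n @[n --> \oo] --> - G + (G - c0) * 0.
  by apply: cvgD; [exact: cvg_cst|apply: cvgMr; exact: cvg_harmonic].
by rewrite mulr0 addr0.
Qed.

End MarkovEntropy.

(** * The potential *)

Section Distance.
Context {R : realType}.
Local Notation dist := (@dist R).

Lemma dist_neq (x y : Sigma) : x 0%N != y 0%N -> dist x y = 1.
Proof.
move=> xy; rewrite /Defs.dist; case: pselect => [h|[]]; last by exists 0%N.
case: ex_minnP => m _ /(_ _ xy); rewrite leqn0 => /eqP ->.
by rewrite expr0 invr1.
Qed.

Lemma dist_shift (x y : Sigma) : x 0%N = y 0%N ->
  dist x y = dist (sigma_shift x) (sigma_shift y) / 2.
Proof.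
move=> xy; rewrite /Defs.dist; case: pselect => [h|nh]; case: pselect => [h'|nh'].
- case: ex_minnP => m hm mmin; case: ex_minnP => m' hm' m'min.
  suff -> : m = m'.+1 by rewrite exprS invfM mulrC.
  case: m hm mmin => [|m] hm mmin; first by rewrite xy eqxx in hm.
  congr _.+1; apply/eqP; rewrite eqn_leq; apply/andP; split.
    exact: (mmin m'.+1 hm').
  exact: (m'min m hm).
- case: nh'; case: h => -[|m] hm; first by rewrite xy eqxx in hm.
  by exists m.
- by case: nh; case: h' => m hm; exists m.+1.
- by rewrite mul0r.
Qed.

Lemma dist_ge0 (x y : Sigma) : 0 <= dist x y.
Proof.
by rewrite /Defs.dist; case: pselect => // h; rewrite invr_ge0 exprn_ge0.
Qed.

Lemma dist_le1 (x y : Sigma) : dist x y <= 1.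
Proof.
rewrite /Defs.dist; case: pselect => // h.
by rewrite invf_le1 ?exprn_gt0// exprn_ege1// ler1n.
Qed.

Lemma dist_variation n (x y z : Sigma) : cyl n y x ->
  `|dist x z - dist y z| <= (2 ^+ n)^-1.
Proof.
elim: n x y z => [|n IH] x y z xy.
  rewrite expr0 invr1 ler_norml; have := dist_ge0 x z; have := dist_ge0 y z.
  have := dist_le1 x z; have := dist_le1 y z => ? ? ? ?; apply/andP; split; lra.
have xy0 : x 0%N = y 0%N by exact: xy.
have [xz|xz] := eqVneq (x 0%N) (z 0%N); last first.
  rewrite !dist_neq -?xy0// subrr normr0 invr_ge0 exprn_ge0//.
rewrite (dist_shift x z)// (dist_shift y z) -?xy0// -mulrBl normrM (@ger0_norm _ 2^-1)// exprS invfM mulrC.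
by rewrite ler_wpM2l//; apply: IH => i ilt; exact: (xy i.+1).
Qed.

End Distance.

Section Potential.
Context {R : realType}.
Variable alpha : R.
Hypothesis alpha0 : 0 < alpha.
Local Notation dist := (@dist R).
Local Notation pot := (potential alpha).

Lemma potential_variation n (x y : Sigma) : cyl n y x ->
  `|pot x - pot y| <= (3 + alpha) / 2 ^+ n.
Proof.
case: n => [|n] xy.
  rewrite expr0 divr1 ler_norml /potential.
  have := @dist_le1 R x zeros; have := @dist_le1 R x ones; have := @dist_le1 R y zeros.
  have := @dist_le1 R y ones; have := @dist_ge0 R x zeros; have := @dist_ge0 R x ones.
  have := @dist_ge0 R y zeros; have := @dist_ge0 R y ones => ? ? ? ? ? ? ? ?.
  have a0 := alpha0; apply/andP; split; case: (ord3P (x 0%N)) => ->; case: (ord3P (y 0%N)) => -> /=; try lra.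
have e := xy 0%N isT.
have h0 := @dist_variation R _ _ _ zeros xy; have h1 := @dist_variation R _ _ _ ones xy.
have u0 : 0 <= (2 ^+ n.+1)^-1 :> R by rewrite invr_ge0 exprn_ge0.
rewrite /potential -e; move: h0 h1 u0; set u := (2 ^+ n.+1)^-1.
rewrite !ler_norml => /andP[? ?] /andP[? ?] u0.
have ua : 0 <= alpha * u by rewrite mulr_ge0// ltW.
by case: (ord3P (x 0%N)) => -> /=; apply/andP; split; lra.
Qed.

Lemma potential_scons0 x : pot (scons o0 x) = - dist x zeros / 2.
Proof. by rewrite /potential /= dist_shift// mulNr. Qed.

Lemma potential_scons1 x : pot (scons o1 x) = - 3 * dist x ones / 2.
Proof. by rewrite /potential /= dist_shift// mulrA. Qed.

Lemma potential_scons2 x : pot (scons o2 x) = - alpha.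
Proof. by []. Qed.

(** The limiting cost of a whole run, charged at the moment it ends: [1/2 + 1/4 + ... = 1] for 0s
    and three times as much for 1s. *)
Definition exit_cost (a b : 'I_3) : R :=
  if a == o0 then (b != o0)%:R else if a == o1 then 3 * (b != o1)%:R else 0.

Let deficit (x : Sigma) : R := - pot x - alpha * (x 0%N == o2)%:R.

(** Inside a run the distance to the fixed point is half that of the shifted point; at an exit the
    deficit is half the exit cost. Integrated against an invariant measure, the recursion gives
    [\int deficit <= \int exit_cost]. *)
Lemma deficit_le x : deficit x <= exit_cost (x 0%N) (x 1%N) / 2 + deficit (sigma_shift x) / 2.
Proof.
rewrite -[x]scons_shift /deficit; set y := sigma_shift x; rewrite shift_scons /=.
have deficit0 : 0 <= - pot y - alpha * (y 0%N == o2)%:R.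
  rewrite /potential; have := @dist_ge0 R y zeros; have := @dist_ge0 R y ones.
  by case: (ord3P (y 0%N)) => -> /=; lra.
have E0 : y 0%N = o0 -> pot y = - dist y zeros by rewrite /potential => ->.
have E1 : y 0%N = o1 -> pot y = - 3 * dist y ones by rewrite /potential => ->.
rewrite /exit_cost.
case: (ord3P (x 0%N)) => -> /=.
- rewrite potential_scons0; have [yo|yo] := eqVneq (y 0%N) o0.
    by rewrite E0// yo /=; lra.
  by rewrite dist_neq//=; lra.
- rewrite potential_scons1; have [yo|yo] := eqVneq (y 0%N) o1.
    by rewrite E1// yo /=; lra.
  by rewrite dist_neq//=; lra.
- by rewrite potential_scons2; lra.
Qed.

Lemma Rint_potential_ge (nu : probability BSigma R) :
  Defs.invariant (sigma_shift : BSigma -> BSigma) nu ->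
  - (\int[nu]_x (exit_cost (x 0%N) (x 1%N) + alpha * (x 0%N == o2)%:R)) <= \int[nu]_x pot x.
Proof.
move=> inv; have mS := measurable_shift R.
have bpot : bdd_mfun (pot : BSigma -> R).
  exact: (variation_bdd_mfun _ (3 + alpha)) potential_variation.
have b2 : bdd_mfun (fun x : BSigma => alpha * (x 0%N == o2)%:R).
  exact: (bdd_mfun_two (fun a _ => alpha * (a == o2)%:R)).
have be : bdd_mfun (fun x : BSigma => exit_cost (x 0%N) (x 1%N)).
  exact: (bdd_mfun_two exit_cost).
have gE x : deficit x = - 1 * pot x + - 1 * (alpha * (x 0%N == o2)%:R) by rewrite /deficit; lra.
have bdeficit : bdd_mfun (deficit : BSigma -> R).
  by rewrite (funext gE); apply: bdd_mfunD; exact: bdd_mfunZ.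
have := le_Rint nu _ _ bdeficit _ deficit_le.
have -> : \int[nu]_x (exit_cost (x 0%N) (x 1%N) / 2 + deficit (sigma_shift x) / 2) =
   (\int[nu]_x exit_cost (x 0%N) (x 1%N)) / 2 + (\int[nu]_x deficit x) / 2.
  under eq_Rintegral do rewrite mulrC [X in _ + X]mulrC.
  rewrite RintD; [|exact: bdd_mfunZ|apply: bdd_mfunZ; exact: bdd_mfun_comp].
  rewrite RintZ// RintZ; last exact: bdd_mfun_comp.
  by rewrite (Rint_invariant _ _ mS)// mulrC [X in _ + X]mulrC.
rewrite RintD//.
have -> : \int[nu]_x deficit x = - (\int[nu]_x pot x) - \int[nu]_x (alpha * (x 0%N == o2)%:R).
  under eq_Rintegral do rewrite gE.
  rewrite RintD; [|exact: bdd_mfunZ|exact: bdd_mfunZ].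
  have RN f : bdd_mfun f -> \int[nu]_x (- 1 * f x) = - (\int[nu]_x f x).
    by move=> bf; rewrite RintZ// mulN1r.
  by rewrite (RN (pot : BSigma -> R))// RN.
move=> h; have : bdd_mfun (fun x : BSigma => exit_cost (x 0%N) (x 1%N) / 2 + deficit (sigma_shift x) / 2).
  under eq_fun do rewrite mulrC [X in _ + X]mulrC.
  by apply: bdd_mfunD; [exact: bdd_mfunZ|apply: bdd_mfunZ; exact: bdd_mfun_comp].
by move=> /h; lra.
Qed.

End Potential.

(** * An explicit supersolution for the perturbed potential *)

Section Supersolution.
Context {R : realType}.

(* Up to normalisation, [run_weight g z d] dominates the total weight of the
   continuations of a point at distance [d] from the fixed point, a run of
   length [k] carrying the weight [z ^+ k * expR (- g * (d - d / 2 ^+ k))]. *)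
Definition run_weight (g z d : R) := expR (- (g * d)) / (1 - z) + 2 * g * d.

(** Dominates the weight of all nonempty runs put in front of a point that starts with another
    symbol: the first symbol prepended brings that point to distance [1 / 2]. *)
Definition exit_weight (g z : R) := z * expR (- (g / 2)) * run_weight g z (1 / 2).

(** The exact weights satisfy [S d = 1 + z * expR (- (g * d / 2)) * S (d / 2)]. In [run_weight], the
    factors [expR (- g * (d - d / 2 ^+ k))] are replaced by [expR (- (g * d))]; each replacement
    loses at most [g * d / 2 ^+ k], whence the term [2 * g * d]. *)
Lemma run_weight_halve (g z d : R) : 0 <= g -> 0 <= d -> 0 < z < 1 ->
  z * expR (- (g * d / 2)) * run_weight g z (d / 2) + 1 <= run_weight g z d.
Proof.
move=> g0 d0 /andP[z0 z1]; rewrite /run_weight.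
have z1' : 1 - z != 0 by rewrite gt_eqF// subr_gt0.
have -> : g * (d / 2) = g * d / 2 by rewrite mulrA.
have -> : expR (- (g * d)) = expR (- (g * d / 2)) * expR (- (g * d / 2)).
  by rewrite -expRD; congr expR; lra.
have : 1 - g * d <= expR (- (g * d / 2)) * expR (- (g * d / 2)).
  by rewrite -expRD (_ : - _ + _ = - (g * d)) ?expR_ge1Dx//; lra.
have gd0 : 0 <= g * d by rewrite mulr_ge0.
have : expR (- (g * d / 2)) <= 1 by rewrite -[leRHS]expR0 ler_expR; lra.
have := expR_gt0 (- (g * d / 2)).
set E := expR _ => E0 E1 Egd.
rewrite -subr_ge0 (_ : _ - _ = (E * E + 2 * (g * d) - (z * E) * (g * d)) - 1); last by field.
have : (z * E) * (g * d) <= g * d by rewrite ler_piMl// mulr_ile1// ltW.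
lra.
Qed.

Lemma exit_weight_le (g v : R) : 0 <= g -> 0 < v ->
  exit_weight g (expR (- v)) <= expR (- g) / v + g * expR (- (g / 2)).
Proof.
move=> g0 v0; rewrite /exit_weight /run_weight.
have z1 : expR (- v) < 1 by rewrite -expR0 ltr_expR; lra.
have zv : expR (- v) * (1 + v) <= 1.
  by rewrite expRN -ler_pdivlMl ?invr_gt0 ?expR_gt0// invrK mulr1 expR_ge1Dx.
have -> : expR (- g) = expR (- (g / 2)) * expR (- (g / 2)).
  by rewrite -expRD; congr expR; lra.
have := expR_gt0 (- v); have := expR_gt0 (- (g / 2)); rewrite mul1r.
set z := expR (- v) in z1 zv *; set E := expR _ => E0 z0.
have -> : z * E * (E / (1 - z) + 2 * g / 2) = E * E * (z / (1 - z)) + z * (g * E).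
  by field; rewrite gt_eqF// subr_gt0.
apply: lerD; last by rewrite ler_piMl ?mulr_ge0// ltW.
apply: ler_wpM2l; first by rewrite mulr_ge0// ltW.
rewrite ler_pdivrMr ?subr_gt0// mulrC -ler_pdivrMr ?invr_gt0// invrK; lra.
Qed.

Variables (alpha beta v0 v1 : R).
Hypothesis alpha0 : 0 < alpha.
Hypothesis beta0 : 0 < beta.
Hypothesis v00 : 0 < v0.
Hypothesis v10 : 0 < v1.

Local Notation dist := (@dist R).
Local Notation pot := (potential alpha).

Let z0 := expR (- v0).
Let z1 := expR (- v1).
Let F0 := exit_weight beta z0.
Let F1 := exit_weight (3 * beta) z1.
Let F2 := expR (- (alpha * beta)) * z1.

Hypothesis F_le : (1 + F0) * (F1 + F2) <= 1.

(** With [v1] as the candidate pressure, each further 0 of a run carries the factor [expR (- v0)]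
    and each further 1 the factor [expR (- v1)]. *)
Definition tilted (x : Sigma) : R := beta * pot x + (v1 - v0) * (x 0%N == o0)%:R.

Definition eigen (x : Sigma) : R :=
  if x 0%N == o0 then run_weight beta z0 (dist x zeros) * z1 / (1 + F0)
  else if x 0%N == o1 then run_weight (3 * beta) z1 (dist x ones) * z1 / (1 + F1)
  else z1.

Let z001 : 0 < z0 < 1.
Proof. by rewrite /z0 expR_gt0 -expR0 ltr_expR oppr_lt0. Qed.

Let z101 : 0 < z1 < 1.
Proof. by rewrite /z1 expR_gt0 -expR0 ltr_expR oppr_lt0. Qed.

Lemma run_weight_bounds (g z d : R) : 0 <= g -> 0 < z < 1 -> 0 <= d <= 1 ->
  expR (- g) <= run_weight g z d <= (1 - z)^-1 + 2 * g.
Proof.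
move=> g0 /andP[zp zl] /andP[d0 d1]; rewrite /run_weight.
have z1' : 1 <= (1 - z)^-1 by rewrite -[leLHS]invr1 lef_pV2 ?posrE// ?subr_gt0//; lra.
have gd : 0 <= g * d <= g by rewrite mulr_ge0//= ler_piMr.
have : expR (- g) <= expR (- (g * d)) by rewrite ler_expR; lra.
have : expR (- (g * d)) <= 1 by rewrite -[leRHS]expR0 ler_expR; lra.
have := expR_gt0 (- (g * d)).
set E := expR (- (g * d)) => Ep E1 gE.
have h1 : E <= E / (1 - z) by rewrite ler_peMr// ltW.
have h2 : E / (1 - z) <= (1 - z)^-1 by rewrite ler_piMl// invr_ge0 subr_ge0 ltW.
by apply/andP; split; lra.
Qed.

Lemma exit_weight_ge0 (g z : R) : 0 <= g -> 0 < z < 1 -> 0 <= exit_weight g z.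
Proof.
move=> g0 z01; have /andP[zp _] := z01; rewrite /exit_weight.
apply: mulr_ge0; first by rewrite mulr_ge0 ?expR_ge0// ltW.
apply: (le_trans (expR_ge0 (- g))).
have h : (0 <= (1 / 2 : R)) && ((1 / 2 : R) <= 1) by apply/andP; split; lra.
by have /andP[] := run_weight_bounds g z (1 / 2) g0 z01 h.
Qed.

Let b30 : 0 < 3 * beta.
Proof. by rewrite mulr_gt0. Qed.

Let F00 : 0 <= F0.
Proof. by apply: exit_weight_ge0 => //; exact: ltW. Qed.

Let F10 : 0 <= F1.
Proof. by apply: exit_weight_ge0 => //; exact: ltW. Qed.

Let F0p : 0 < 1 + F0.
Proof. by rewrite ltr_wpDr. Qed.

Let F1p : 0 < 1 + F1.
Proof. by rewrite ltr_wpDr. Qed.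

(** Sequences are built from runs of 0s, runs of 1s and single 2s. A run cannot follow a run of the
    same symbol, hence the shares [F / (1 + F)]; a 2 may be repeated and keeps [F2]. The sum of the
    shares is 1 at the renewal equation, and [F_le] is a sufficient condition in product form. *)
Lemma F_sum_le1 : F0 / (1 + F0) + F1 / (1 + F1) + F2 <= 1.
Proof.
have -> : F0 / (1 + F0) = 1 - (1 + F0)^-1 by field; rewrite gt_eqF.
have h1 : F1 / (1 + F1) <= F1 by rewrite ler_pdivrMr// ler_peMr// lerDl.
have h0 : F1 + F2 <= (1 + F0)^-1 by rewrite -[leRHS]mul1r ler_pdivlMr// mulrC.
lra.
Qed.

Lemma eigen_scons0 x :
  expR (tilted (scons o0 x)) * eigen (scons o0 x) =
  z0 * expR (- (beta * dist x zeros / 2)) * run_weight beta z0 (dist x zeros / 2) / (1 + F0).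
Proof.
rewrite /tilted /eigen /= potential_scons0 (dist_shift (scons o0 x) zeros)//.
rewrite shift_scons (_ : sigma_shift zeros = zeros)// mulr1.
rewrite (_ : beta * _ + _ = - (beta * dist x zeros / 2) + v1 - v0); last by lra.
rewrite !expRD -/z0; have -> : expR v1 = z1^-1 by rewrite /z1 expRN invrK.
by field; rewrite gt_eqF//= gt_eqF// expR_gt0.
Qed.

Lemma eigen_scons1 x :
  expR (tilted (scons o1 x)) * eigen (scons o1 x) =
  z1 * expR (- (3 * beta * dist x ones / 2)) * run_weight (3 * beta) z1 (dist x ones / 2) / (1 + F1).
Proof.
rewrite /tilted /eigen /= potential_scons1 (dist_shift (scons o1 x) ones)//.
rewrite shift_scons (_ : sigma_shift ones = ones)// mulr0 addr0.
rewrite (_ : beta * _ = - (3 * beta * dist x ones / 2)); last by lra.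
by field; rewrite gt_eqF.
Qed.

Lemma eigen_scons2 x : expR (tilted (scons o2 x)) * eigen (scons o2 x) = F2.
Proof.
rewrite /tilted /eigen /= potential_scons2 mulr0 addr0 /F2 mulrN.
by rewrite [beta * _]mulrC.
Qed.

(** On [[0]], [run_weight_halve] leaves room [(1 + F0)^-1 = 1 - F0 / (1 + F0)], which by [F_sum_le1]
    covers the other two symbols; on [[1]] likewise. On [[2]] the inequality is [F_sum_le1]
    itself. *)
Lemma eigen_super x :
  \sum_(a : 'I_3) expR (tilted (scons a x)) * eigen (scons a x) <= expR v1 * eigen x.
Proof.
rewrite sum_ord3 eigen_scons0 eigen_scons1 eigen_scons2.
have Fs := F_sum_le1.
have -> : expR v1 = z1^-1 by rewrite /z1 expRN invrK.
have z1n : z1 != 0 by rewrite gt_eqF//; case/andP: z101.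
have e0 : x 0%N != o0 -> z0 * expR (- (beta * dist x zeros / 2)) *
    run_weight beta z0 (dist x zeros / 2) / (1 + F0) = F0 / (1 + F0).
  by move=> x0; rewrite dist_neq// mulr1.
have e1 : x 0%N != o1 -> z1 * expR (- (3 * beta * dist x ones / 2)) *
    run_weight (3 * beta) z1 (dist x ones / 2) / (1 + F1) = F1 / (1 + F1).
  by move=> x0; rewrite dist_neq// mulr1.
have f0 : F0 / (1 + F0) = 1 - (1 + F0)^-1 by field; rewrite gt_eqF.
have f1 : F1 / (1 + F1) = 1 - (1 + F1)^-1 by field; rewrite gt_eqF.
have E (a b : R) : z1^-1 * (a * z1 / b) = a / b.
  by rewrite mulrA [z1^-1 * _]mulrC mulfK.
rewrite /eigen; case: (ord3P (x 0%N)) => xE.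
- rewrite e1 xE//= .
  have h := run_weight_halve beta z0 (dist x zeros) (ltW beta0) (dist_ge0 _ _) z001.
  rewrite -(ler_pM2r (_ : 0 < (1 + F0)^-1)) ?invr_gt0// mulrDl mul1r in h.
  by rewrite E; lra.
- rewrite e0 xE//= .
  have h := run_weight_halve (3 * beta) z1 (dist x ones) (ltW b30) (dist_ge0 _ _) z101.
  rewrite -(ler_pM2r (_ : 0 < (1 + F1)^-1)) ?invr_gt0// mulrDl mul1r in h.
  by rewrite E; lra.
- by rewrite e0 ?e1 ?xE//= mulVf.
Qed.

Lemma eigen_bounds : exists h0 h1 : R,
  [/\ 0 < h0, 0 < h1 & forall x, h0 <= eigen x <= h1].
Proof.
have /andP[z1p z1l] := z101.
have p0 : 0 < z1 / (1 + F0) by rewrite divr_gt0.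
have p1 : 0 < z1 / (1 + F1) by rewrite divr_gt0.
have B0 x := run_weight_bounds beta z0 (dist x zeros) (ltW beta0) z001.
have B1 x := run_weight_bounds (3 * beta) z1 (dist x ones) (ltW b30) z101.
set a0 := expR (- beta); set a1 := expR (- (3 * beta)).
set c0 := (1 - z0)^-1 + 2 * beta; set c1 := (1 - z1)^-1 + 2 * (3 * beta).
exists (Num.min (a0 * (z1 / (1 + F0))) (Num.min (a1 * (z1 / (1 + F1))) z1)).
exists (Num.max (c0 * (z1 / (1 + F0))) (Num.max (c1 * (z1 / (1 + F1))) z1)).
split.
- have a0p : 0 < a0 by exact: expR_gt0.
  have a1p : 0 < a1 by exact: expR_gt0.
  by rewrite !lt_min z1p (mulr_gt0 a0p p0) (mulr_gt0 a1p p1).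
- by rewrite !lt_max z1p !orbT.
- move=> x; have dz : 0 <= dist x zeros <= 1 by rewrite dist_ge0 dist_le1.
  have do_ : 0 <= dist x ones <= 1 by rewrite dist_ge0 dist_le1.
  have /andP[l0 u0] := B0 x dz; have /andP[l1 u1] := B1 x do_.
  rewrite /eigen; case: ifP => _; [|case: ifP => _].
  + rewrite -mulrA ge_min le_max (ler_wpM2r (ltW p0) l0) (ler_wpM2r (ltW p0) u0)//.
  + rewrite -mulrA !ge_min !le_max (ler_wpM2r (ltW p1) l1) (ler_wpM2r (ltW p1) u1)//.
    by rewrite !orbT.
  + by rewrite !ge_min !le_max !lexx !orbT.
Qed.

Lemma tilted_variation n (x y : Sigma) : cyl n y x ->
  `|tilted x - tilted y| <= (beta * (3 + alpha) + `|v1 - v0|) / 2 ^+ n.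
Proof.
move=> xy; rewrite /tilted.
set b := _%:R; set b' := _%:R.
have -> : beta * pot x + (v1 - v0) * b - (beta * pot y + (v1 - v0) * b') =
  beta * (pot x - pot y) + (v1 - v0) * (b - b') by ring.
apply: (le_trans (ler_normD _ _)); rewrite [leRHS]mulrDl; apply: lerD.
  rewrite normrM (gtr0_norm beta0) -mulrA.
  by apply: ler_wpM2l; [exact: ltW|exact: potential_variation].
rewrite normrM ler_wpM2l//; case: n xy => [|n] xy.
  rewrite expr0 invr1 /b /b'; case: (_ == _); case: (_ == _);
  by rewrite ?subrr ?subr0 ?sub0r ?normrN ?normr1 ?normr0.
by rewrite /b /b' (xy 0%N)// subrr normr0 invr_ge0 exprn_ge0.
Qed.

Lemma KS_entropy_le_tilted (mu : probability BSigma R) :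
  Defs.invariant (sigma_shift : BSigma -> BSigma) mu ->
  (KS_entropy (sigma_shift : BSigma -> BSigma) mu <=
   (v1 - beta * (\int[mu]_x pot x) - (v1 - v0) * (\int[mu]_x (x 0%N == o0)%:R))%:E)%E.
Proof.
move=> inv; have [h0 [h1 [h00 h10 hb]]] := eigen_bounds.
have bpot : bdd_mfun (pot : BSigma -> R).
  by apply: (variation_bdd_mfun _ (3 + alpha)) => n x y; exact: potential_variation.
have bi : bdd_mfun (fun x : BSigma => (x 0%N == o0)%:R : R).
  exact: (bdd_mfun_two (fun a _ => (a == o0)%:R)).
have -> : v1 - beta * (\int[mu]_x pot x) - (v1 - v0) * (\int[mu]_x (x 0%N == o0)%:R) =
    ln (expR v1) - \int[mu]_x tilted x.
  rewrite expRK RintD; [|exact: bdd_mfunZ|exact: bdd_mfunZ].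
  by rewrite RintZ// RintZ// opprD addrA.
have e0 x : 0 < eigen x by have /andP[h _] := hb x; exact: lt_le_trans h.
apply: (KS_entropy_le _ tilted eigen (expR v1) (beta * (3 + alpha) + `|v1 - v0|)
  (`|ln h0| + `|ln h1|) mu) => //.
- exact: expR_gt0.
- exact: eigen_super.
- exact: tilted_variation.
- move=> x; have /andP[hx0 hx1] := hb x.
  have l0 : ln h0 <= ln (eigen x) by rewrite ler_ln ?posrE.
  have l1 : ln (eigen x) <= ln h1 by rewrite ler_ln ?posrE.
  have := ler_norm (ln h1); have := ler_norm (- ln h0); rewrite normrN.
  have := normr_ge0 (ln h0); have := normr_ge0 (ln h1) => ? ? ? ?.
  rewrite ler_norml; apply/andP; split; lra.
Qed.

End Supersolution.

(** * Asymptotics of the pressure and of the masses *)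

Section TestMeasure.
Context {R : realType}.
Variables (alpha beta eps p r : R).
Hypothesis alpha0 : 0 < alpha.
Hypothesis beta0 : 0 < beta.
Hypothesis p0 : 0 < p.
Hypothesis r0 : 0 < r.
Hypothesis eps1 : eps < 1.
Hypothesis pr_eps : p + r = eps.
Hypothesis ln_p : ln p + ln eps = - (4 * beta).
Hypothesis ln_r : ln r = - (beta * (1 + alpha)).

Let eps0 : 0 < eps. Proof. by rewrite -pr_eps addr_gt0. Qed.

Let Z := 1 + p / eps + r.

Let Z0 : 0 < Z. Proof. by rewrite !addr_gt0// divr_gt0. Qed.

Let M (a b : 'I_3) : R :=
  if a == o0 then (if b == o0 then 1 - eps else if b == o1 then p else r)
  else if a == o1 then (if b == o0 then eps else if b == o1 then 1 - eps else 0)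
  else (b == o0)%:R.

Let pi (a : 'I_3) : R :=
  if a == o0 then Z^-1 else if a == o1 then p / eps / Z else r / Z.

(** The relations on [ln p], [ln eps] and [ln r] make the entropy of the transitions cancel the cost
    of both loops exactly. Only the entropy [- (1 - eps) * ln (1 - eps)] of staying at 0 or at 1
    remains. *)
Lemma test_measure : exists nu : probability BSigma R,
  Defs.invariant (sigma_shift : BSigma -> BSigma) nu /\
  ((eps * (1 - eps) ^+ 2 - beta * (\int[nu]_x potential alpha x))%:E <=
   KS_entropy (sigma_shift : BSigma -> BSigma) nu)%E.
Proof.
have prE := pr_eps; have e0 : eps != 0 by rewrite gt_eqF.
have Zn : Z != 0 by rewrite gt_eqF.
have ZE : Z * eps = eps + p + r * eps by rewrite /Z; field.
have M_stoch a : stochastic (M a).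
  split=> [b|].
    by case: (ord3P a) => ->; case: (ord3P b) => ->; rewrite /M//= ltW// subr_gt0.
  by rewrite sum_ord3; case: (ord3P a) => ->; rewrite /M/=; lra.
have pi_stoch : stochastic pi.
  split=> [b|].
    by case: (ord3P b) => ->; rewrite /pi/= ltW// ?invr_gt0// !divr_gt0.
  by rewrite sum_ord3 /pi/= -{1}[Z^-1]mul1r -!mulrDl mulfV.
have pi_stat b : \sum_a pi a * M a b = pi b.
  rewrite sum_ord3 /pi /M/=; case: (ord3P b) => -> /=; rewrite -pr_eps; field;
    by rewrite pr_eps ?e0 ?Zn.
have [nu [inv nucyl]] := markov_exists M M_stoch pi pi_stoch pi_stat.
exists nu; split => //.
apply: le_trans (markov_entropy M pi M_stoch pi_stoch nu inv nucyl); rewrite lee_fin.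
have := Rint_potential_ge _ alpha0 nu inv.
rewrite (Rint_two M pi nu nucyl (fun a b => exit_cost a b + alpha * (a == o2)%:R)).
rewrite !sum_ord3 /M /pi /exit_cost/= ln1 ?(mulr0, mul0r, addr0, add0r, mulr1).
set Pot := \int[nu]_x _.
have lnr := ln_r; have lnp := ln_p.
have l1 : ln (1 - eps) <= - eps by rewrite le_ln1Dx// ltrN2.
set L := ln (1 - eps) in l1 *; set lp := ln p in lnp *; set le := ln eps in lnp *.
rewrite lnr.
set A := p / eps; set iZ := Z^-1.
have A0 : 0 < A by rewrite divr_gt0.
have Ae : A * eps = p by rewrite /A divfK.
have iZ0 : 0 < iZ by rewrite invr_gt0.
have eA : A / Z * eps = iZ * p by rewrite -Ae /iZ mulrAC mulrC.
rewrite eA -/iZ => hPot.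
have re : r <= eps by rewrite -prE lerDr ltW.
(* The right side is the stationary mass of the symbols 0 and 1. *)
have h1 : 1 - eps <= iZ * (1 + A).
  rewrite mulrC ler_pdivlMr// /Z -/A.
  have : 0 <= eps * A by rewrite mulr_ge0// ltW.
  have : 0 <= eps * r by rewrite mulr_ge0// ltW.
  lra.
have e1 : 0 <= 1 - eps by rewrite subr_ge0 ltW.
have h2 : eps * (1 - eps) ^+ 2 <= (1 - eps) * eps * (iZ * (1 + A)).
  rewrite expr2 mulrA [eps * _]mulrC; apply: ler_wpM2l => //.
  by rewrite mulr_ge0// ltW.
have h3 : (1 - eps) * (iZ * (1 + A)) * eps <= (1 - eps) * (iZ * (1 + A)) * - L.
  apply: ler_wpM2l; last by rewrite lerNr.
  by rewrite mulr_ge0// (le_trans e1).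
have h4 := ler_wpM2l (ltW beta0) hPot.
have h5 : iZ * p * (lp + le) = iZ * p * - (4 * beta) by rewrite lnp.
rewrite -/iZ (_ : A / Z = iZ * A) 1?mulrC// (_ : r / Z = iZ * r) 1?mulrC// in h4 *.
lra.
Qed.

End TestMeasure.

(* With [s] the perturbation in units of the pressure gap and [y] the resulting
   pressure, [y - s - (A / y + 1 - A)] vanishes to first order in [s] exactly
   when [y] has slope [(1 + A)^-1]. *)
Lemma perturbed_gap (R : realType) (A s c y : R) : 0 < A <= 1 -> `|s| <= 1 / 8 ->
  c * (1 + A) = 1 -> y = 1 + c * s + 2 * s ^+ 2 ->
  [/\ 1 / 2 <= y, 1 / 2 <= y - s, y - s <= 2 &
      A + (1 - A) * y <= (1 - s ^+ 2 / 5) * ((y - s) * y)].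
Proof.
move=> /andP[A0 A1]; rewrite ler_norml => /andP[s0 s1] cA ->.
have c0 : 1 / 2 <= c by nra.
have c1 : c <= 1 by nra.
pose k := c + 2 * s.
have ks : 1 + c * s + 2 * s ^+ 2 = 1 + s * k by rewrite /k; ring.
have k0 : 1 / 4 <= k by rewrite /k; lra.
have k1 : k <= 5 / 4 by rewrite /k; lra.
rewrite ks; have y0 : 1 / 2 <= 1 + s * k by nra.
have u0 : 1 / 2 <= 1 + s * k - s by nra.
have u1 : 1 + s * k - s <= 2 by nra.
split => //.
have s2 : 0 <= s ^+ 2 by exact: sqr_ge0.
(* By [c * (1 + A) = 1] the orders 0 and 1 in [s] cancel; the term [2 * s ^+ 2] of [y] is there to
   make the remaining second-order slack positive. *)
have -> : A + (1 - A) * (1 + s * k) = (1 + s * k - s) * (1 + s * k)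
    - (2 * s ^+ 2 * (1 + A) * (1 + s * k) - A * (s * k) ^+ 2).
  transitivity ((1 + s * k - s) * (1 + s * k)
    - (2 * s ^+ 2 * (1 + A) * (1 + s * k) - A * (s * k) ^+ 2)
    - s * (1 + s * k) * (c * (1 + A) - 1)); first by rewrite /k; ring.
  by rewrite cA subrr mulr0 subr0.
have k2 : k ^+ 2 <= 25 / 16.
  by rewrite (_ : 25 / 16 = (5 / 4) ^+ 2); [rewrite ler_sqr ?nnegrE//; lra|field].
have sk2 : A * (s * k) ^+ 2 <= s ^+ 2 * (25 / 16) * A.
  by rewrite exprMn [leLHS]mulrC ler_wpM2r ?ler_wpM2l// ltW.
have y1 : 27 / 32 <= 1 + s * k by nra.
have g1 : 2 * s ^+ 2 * (1 + A) * (27 / 32) <= 2 * s ^+ 2 * (1 + A) * (1 + s * k).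
  by apply: ler_wpM2l => //; apply: mulr_ge0; [exact: mulr_ge0|lra].
have g2 : s ^+ 2 * ((1 + s * k - s) * (1 + s * k)) <= s ^+ 2 * (2 * (37 / 32)).
  apply: ler_wpM2l => //; apply: ler_pM; try lra; nra.
have sA : 0 <= s ^+ 2 * A <= s ^+ 2 by rewrite mulr_ge0 ?ler_piMr// ltW.
lra.
Qed.

Section PressureGap.
Context {R : realType}.
Variables (alpha beta : R).
Hypothesis alpha0 : 0 < alpha.
Hypothesis beta0 : 0 < beta.

(* In the notation of the header, [gap] is [e], [gap_r] is [r], [gap_q] is [p e]
   and [excursion_ratio] is [a]. *)
Definition gap_r := expR (- (beta * (1 + alpha))).
Definition gap_q := expR (- (4 * beta)).
Definition gap := (gap_r + Num.sqrt (gap_r ^+ 2 + 4 * gap_q)) / 2.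

Let r0 : 0 < gap_r. Proof. exact: expR_gt0. Qed.
Let q0 : 0 < gap_q. Proof. exact: expR_gt0. Qed.

Lemma gap_gt0 : 0 < gap.
Proof. by rewrite divr_gt0// ltr_wpDr// sqrtr_ge0. Qed.

(** Divided by [gap], this is the relation [p + r = e] of the test measure; divided by [gap ^+ 2],
    it is the renewal equation [excursion_ratioE]. *)
Lemma gap_eq : gap ^+ 2 = gap_r * gap + gap_q.
Proof.
have h : 0 <= gap_r ^+ 2 + 4 * gap_q by rewrite addr_ge0 ?sqr_ge0// mulr_ge0// ltW.
have := sqr_sqrtr h; rewrite /gap; set S := Num.sqrt _ => SE.
have -> : gap_q = (S ^+ 2 - gap_r ^+ 2) / 4 by rewrite SE; field.
by field.
Qed.

Definition excursion_ratio := gap_q / gap ^+ 2.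

Lemma excursion_ratio_gt0 : 0 < excursion_ratio.
Proof. by rewrite divr_gt0// exprn_gt0// gap_gt0. Qed.

Lemma excursion_ratioE : excursion_ratio + gap_r / gap = 1.
Proof.
have g0 := gap_gt0; have gn : gap != 0 by rewrite gt_eqF.
have -> : excursion_ratio + gap_r / gap = (gap_r * gap + gap_q) / gap ^+ 2.
  by rewrite /excursion_ratio; field.
by rewrite -gap_eq divff// expf_neq0.
Qed.

Lemma gap_ge : expR (- (2 * beta)) <= gap.
Proof.
have g0 := ltW gap_gt0; rewrite -ler_sqr ?nnegrE ?expR_ge0// gap_eq.
rewrite -expRM_natl (_ : _ * _ = - (4 * beta)); last by ring.
by rewrite -/gap_q lerDr; apply: mulr_ge0 => //; exact: ltW.
Qed.

Lemma gap_le : gap <= 2 * expR (- beta).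
Proof.
have b0 := beta0; have g0 := gap_gt0; have E0 := expR_gt0 (- beta).
have rE : gap_r <= expR (- beta).
  by rewrite ler_expR lerN2 mulrDr mulr1 lerDl mulr_ge0// ltW.
have qE : gap_q <= expR (- beta) ^+ 2.
  by rewrite -expRM_natl ler_expR; lra.
rewrite leNgt; apply/negP => h; have := gap_eq.
have h1 : (2 * expR (- beta)) * gap <= gap * gap by rewrite ler_wpM2r// ltW.
have h2 : gap_r * gap <= expR (- beta) * gap by rewrite ler_wpM2r// ltW.
have h3 : expR (- beta) * (2 * expR (- beta)) < expR (- beta) * gap by rewrite ltr_pM2l.
move: qE; rewrite !expr2; nra.
Qed.

End PressureGap.

Lemma expRN_le_inv (R : realType) (x : R) : 0 < x -> expR (- x) <= x^-1.
Proof.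
move=> x0; rewrite expRN lef_pV2 ?posrE ?expR_gt0//.
by have := expR_ge1Dx x; lra.
Qed.

(** The exponential is the square of [expR (- (x / 4)) <= 4 / x]. *)
Lemma mulr_expRN_half_le (R : realType) (x : R) : 0 < x -> x * expR (- (x / 2)) <= 16 / x.
Proof.
move=> x0; have x4 : 0 < x / 4 by rewrite divr_gt0.
have -> : expR (- (x / 2)) = expR (- (x / 4)) ^+ 2.
  by rewrite -expRM_natl; congr expR; field.
have h := expRN_le_inv _ _ x4.
have : expR (- (x / 4)) ^+ 2 <= (x / 4)^-1 ^+ 2.
  by rewrite ler_sqr ?nnegrE ?expR_ge0// invr_ge0 ltW.
move=> /(ler_wpM2l (ltW x0)) => h2; apply: (le_trans h2).
by rewrite le_eqVlt; apply/orP; left; apply/eqP; field; rewrite gt_eqF.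
Qed.

Section Equilibrium.
Context {R : realType}.
Variables (alpha beta : R) (mu : probability BSigma R).
Hypothesis alpha0 : 0 < alpha.
Hypothesis beta0 : 0 < beta.
Hypothesis mu_eq : equilibrium_state (sigma_shift : BSigma -> BSigma)
  (fun x => beta * potential alpha x) mu.
Hypothesis gap1 : gap alpha beta < 1.

Local Notation pot := (potential alpha).
Local Notation g := (gap alpha beta).
Local Notation KS := (KS_entropy (sigma_shift : BSigma -> BSigma)).

Lemma potential_bdd_mfun : bdd_mfun (pot : BSigma -> R).
Proof.
by apply: (variation_bdd_mfun _ (3 + alpha)) => n x y; exact: potential_variation.
Qed.

Lemma free_energy_ge : ((g * (1 - g) ^+ 2 - beta * (\int[mu]_x pot x))%:E <= KS mu)%E.
Proof.
have g0 : 0 < g by exact: gap_gt0.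
have gn : g != 0 by rewrite gt_eqF.
have q0 : 0 < gap_q beta by exact: expR_gt0.
have r0 : 0 < gap_r alpha beta by exact: expR_gt0.
have p0 : 0 < gap_q beta / g by rewrite divr_gt0.
have pr : gap_q beta / g + gap_r alpha beta = g.
  apply: (mulIf gn); rewrite mulrDl divfK// -[RHS]expr2 gap_eq addrC.
  by rewrite -/g.
have lp : ln (gap_q beta / g) + ln g = - (4 * beta).
  by rewrite -lnM ?posrE// divfK// expRK.
have lr : ln (gap_r alpha beta) = - (beta * (1 + alpha)) by rewrite expRK.
have [nu [inv hnu]] := test_measure alpha beta g _ _ alpha0 beta0 p0 r0 gap1 pr lp lr.
have := mu_eq.2 nu inv; have bp := potential_bdd_mfun.
have E (P : probability BSigma R) :
    (\int[P]_x (beta * pot x)%:E)%E = (beta * (\int[P]_x pot x))%:E.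
  by rewrite EFin_Rint ?RintZ//; exact: bdd_mfunZ.
rewrite !E => h; rewrite EFinB leeBlDr//; apply: le_trans h.
by rewrite -leeBlDr// -EFinB.
Qed.

Lemma KS_entropy_le_ln3 : (KS mu <= (ln 3)%:E)%E.
Proof.
have -> : ln 3 = ln 3 - (\int[mu]_x 0) :> R by rewrite Rint_cst subr0.
apply: (KS_entropy_le R (fun=> 0) (fun=> 1) 3 0 0 mu) => //.
- by move=> x; rewrite sum_ord3 expR0; lra.
- by move=> n x y _; rewrite subrr normr0 mul0r.
- by move=> x; rewrite ln1 normr0.
- exact: mu_eq.1.
Qed.

Lemma potential_ge : - (ln 3 / beta) <= \int[mu]_x pot x.
Proof.
have := le_trans free_energy_ge KS_entropy_le_ln3; rewrite lee_fin => h.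
have g0 : 0 <= g * (1 - g) ^+ 2 by rewrite mulr_ge0 ?sqr_ge0// ltW// gap_gt0.
rewrite lerNl ler_pdivlMr//; lra.
Qed.

Let m := \int[mu]_x (x 0%N == o0)%:R.

(** Convexity of the pressure: [v1] bounds it from above after the perturbation [v1 - v0] on [[0]],
    and [g * (1 - g) ^+ 2] from below without it. The numerical condition is [F_le] with the exit
    weights replaced by the estimates of [exit_weight_le]. *)
Lemma mass_le (v0 v1 : R) : 0 < v0 -> 0 < v1 ->
  (1 + (expR (- beta) / v0 + beta * expR (- (beta / 2)))) *
  (expR (- (3 * beta)) / v1 + 3 * beta * expR (- (3 * beta / 2)) + expR (- (alpha * beta))) <= 1 ->
  (v1 - v0) * m <= v1 - g * (1 - g) ^+ 2.
Proof.
move=> v00 v10 F_le.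
have b3 : 0 < 3 * beta by rewrite mulr_gt0.
have z01 (v : R) : 0 < v -> 0 < expR (- v) < 1.
  by move=> v0'; rewrite expR_gt0 -[ltRHS]expR0 ltr_expR oppr_lt0.
have F0 := exit_weight_le _ _ (ltW beta0) v00.
have F1 := exit_weight_le _ _ (ltW b3) v10.
have F00 := exit_weight_ge0 _ _ (ltW beta0) (z01 _ v00).
have F10 := exit_weight_ge0 _ _ (ltW b3) (z01 _ v10).
have /andP[z1 z1'] := z01 _ v10.
have e0 := expR_gt0 (- (alpha * beta)).
have F2 : expR (- (alpha * beta)) * expR (- v1) <= expR (- (alpha * beta)) by rewrite ler_piMr// ltW.
have := KS_entropy_le_tilted alpha beta v0 v1 alpha0 beta0 v00 v10 _ mu mu_eq.1.
have hF : (1 + exit_weight beta (expR (- v0))) *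
  (exit_weight (3 * beta) (expR (- v1)) + expR (- (alpha * beta)) * expR (- v1)) <= 1.
  apply: le_trans F_le; apply: ler_pM; [by lra| |by lra|by lra].
  by rewrite addr_ge0// mulr_ge0// ltW.
move=> /(_ hF) h; have := le_trans free_energy_ge h; rewrite lee_fin -/m; lra.
Qed.

(** [mass_le] is applied with [v0 = g * u] and [v1 = g * y]. The leading part of its condition is [a
    / u * (b / y + f2) = (A + (1 - A) * y) / (u * y)], which [perturbed_gap] keeps below
    [1 - s ^+ 2 / 5]. The other terms are at most [12 * del + 4 * expR (- beta) + 2 * f2], hence at
    most [(196 + 2 / alpha) / beta]; the constant [60 * (17 + alpha^-1)] lets the slack absorb
    them. *)
Lemma mass_tilt_le (s : R) : s != 0 -> `|s| <= 1 / 8 ->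
  60 * (17 + alpha^-1) <= beta * s ^+ 2 ->
  s * m <= s / (1 + excursion_ratio alpha beta) + 4 * s ^+ 2.
Proof.
move=> sn sl bs; have b0 := beta0.
have g0 : 0 < g by exact: gap_gt0.
set A := excursion_ratio alpha beta; have A0 : 0 < A by exact: excursion_ratio_gt0.
have AE : A + gap_r alpha beta / g = 1 by exact: excursion_ratioE.
have rg0 : 0 < gap_r alpha beta / g by rewrite divr_gt0// expR_gt0.
have A01 : 0 < A <= 1 by apply/andP; split; lra.
have cA : (1 + A)^-1 * (1 + A) = 1 by rewrite mulVf// gt_eqF//; lra.
pose y := 1 + (1 + A)^-1 * s + 2 * s ^+ 2.
have [y0 u0 u2 key] := perturbed_gap _ _ _ _ y A01 sl cA erefl.
set u := y - s in u0 u2 key.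
have s2 : 0 < s ^+ 2 by rewrite lt_neqAle eq_sym sqrf_eq0 sn sqr_ge0.
have s64 : s ^+ 2 <= 1 / 64.
  by rewrite -real_normK ?num_real// (_ : 1 / 64 = (1 / 8) ^+ 2); [rewrite ler_sqr ?nnegrE//; lra|field].
have ai0 : 0 < alpha^-1 by rewrite invr_gt0.
have bi : beta^-1 <= s ^+ 2 / (60 * (17 + alpha^-1)).
  rewrite ler_pdivlMr; last by lra.
  by rewrite mulrC ler_pdivrMr// mulrC; lra.
have bi' : beta^-1 * (60 * (17 + alpha^-1)) <= s ^+ 2.
  by rewrite -ler_pdivlMr//; lra.
have bi0 : 0 < beta^-1 by rewrite invr_gt0.
have bia : 0 < beta^-1 * alpha^-1 by rewrite mulr_gt0.
have d0 := mulr_expRN_half_le _ _ beta0.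
have e1 := expRN_le_inv _ _ beta0.
have e2 := expRN_le_inv _ _ (mulr_gt0 alpha0 beta0); rewrite invfM in e2.
set del := beta * expR (- (beta / 2)) in d0 *.
have del0 : 0 < del by rewrite mulr_gt0// expR_gt0.
set f2 := expR (- (alpha * beta)) in e2 *.
have f20 : 0 < f2 by exact: expR_gt0.
set a := expR (- beta) / g; set b := expR (- (3 * beta)) / g.
have a0 : 0 < a by rewrite divr_gt0// expR_gt0.
have b0' : 0 < b by rewrite divr_gt0// expR_gt0.
have ab : a * b = A.
  rewrite /a /b /A /excursion_ratio mulf_div -expRD /gap_q -expr2; congr (expR _ / _); ring.
have af : a * f2 = 1 - A.
  rewrite -AE addrAC subrr add0r /a /f2 /gap_r mulrAC -expRD; congr (expR _ / _); ring.
have gge := gap_ge alpha beta.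
have al : a <= expR beta.
  rewrite ler_pdivrMr//; apply: (le_trans _ (ler_wpM2l (expR_ge0 _) gge)).
  by rewrite -expRD ler_expR; lra.
have bl : b <= expR (- beta).
  rewrite ler_pdivrMr//; apply: (le_trans _ (ler_wpM2l (expR_ge0 _) gge)).
  by rewrite -expRD ler_expR; lra.
set del1 := 3 * beta * expR (- (3 * beta / 2)).
have del10 : 0 < del1 by rewrite !mulr_gt0// expR_gt0.
have ad1 : a * del1 <= 3 * del.
  apply: (@le_trans _ _ (expR beta * del1)); first by rewrite ler_wpM2r// ltW.
  rewrite /del1 /del mulrCA -expRD mulrA.
  have -> : beta + - (3 * beta / 2) = - (beta / 2) by field.
  exact: lexx.
have d1d : del1 <= 3 * del.
  rewrite /del1 /del mulrA; apply: ler_wpM2l; first by rewrite mulr_ge0// ltW.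
  by rewrite ler_expR; lra.
have y0' : 0 < y by lra.
have u0' : 0 < u by lra.
have yi : y^-1 <= 2 by rewrite -[2]invrK lef_pV2 ?posrE//; lra.
have ui : u^-1 <= 2 by rewrite -[2]invrK lef_pV2 ?posrE//; lra.
have ui0 : 0 < u^-1 by rewrite invr_gt0.
have yi0 : 0 < y^-1 by rewrite invr_gt0.
have main : (1 + (a / u + del)) * (b / y + del1 + f2) <= 1.
  have -> : (1 + (a / u + del)) * (b / y + del1 + f2) =
     (A + (1 - A) * y) / (u * y) + a * del1 / u + (1 + del) * (b / y + del1 + f2).
    by rewrite -af -ab; field; rewrite !gt_eqF.
  have t1 : (A + (1 - A) * y) / (u * y) <= 1 - s ^+ 2 / 5.
    by rewrite ler_pdivrMr// mulr_gt0.
  have t2 : a * del1 / u <= 3 * del * 2.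
    by apply: ler_pM => //; [exact/ltW/mulr_gt0|exact: ltW].
  have by_ : b / y <= expR (- beta) * 2 by apply: ler_pM => //; exact: ltW.
  have by0 : 0 < b / y by rewrite divr_gt0.
  have t3 : (1 + del) * (b / y + del1 + f2) <= 2 * (expR (- beta) * 2 + 3 * del + f2).
    apply: ler_pM; lra.
  rewrite [alpha^-1 * _]mulrC in e2; lra.
have gy : 0 < g * y by rewrite mulr_gt0.
have gu : 0 < g * u by rewrite mulr_gt0.
have := mass_le (g * u) (g * y) gu gy.
have -> : expR (- beta) / (g * u) = a / u by rewrite invfM mulrA.
have -> : expR (- (3 * beta)) / (g * y) = b / y by rewrite invfM mulrA.
move=> /(_ main).
have -> : g * y - g * u = g * s by rewrite /u; ring.
rewrite -mulrA -(mulrBr g) ler_pM2l// => h; apply: (le_trans h).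
have gle : g <= 2 * expR (- beta) by exact: gap_le.
(* The loss [1 - (1 - g) ^+ 2 <= 2 * g] of the lower bound is thus of second order in [s]. *)
have gs : g <= s ^+ 2 by lra.
rewrite /y [_^-1 * s]mulrC expr2; nra.
Qed.

(** [mass_tilt_le] at [s] bounds the mass from above, at [- s] from below. *)
Lemma mass_close (s : R) : 0 < s <= 1 / 8 -> 60 * (17 + alpha^-1) <= beta * s ^+ 2 ->
  `|m - (1 + excursion_ratio alpha beta)^-1| <= 4 * s.
Proof.
move=> /andP[s0 s8] bs.
have h1 := mass_tilt_le s (lt0r_neq0 s0).
have h2 := mass_tilt_le (- s); rewrite oppr_eq0 (gt_eqF s0) normrN sqrrN in h2.
rewrite gtr0_norm// in h1 h2.
have := h1 s8 bs; have := h2 isT s8 bs; set c := _^-1 => i2 i1.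
have j1 : s * (m - c) <= s * (4 * s) by lra.
have j2 : s * (c - m) <= s * (4 * s) by lra.
rewrite !ler_pM2l// in j1 j2.
by rewrite ler_norml; apply/andP; split; lra.
Qed.

End Equilibrium.

(** * Concentration on the fixed points and the weak limit *)

Lemma compact_Sigma : compact [set: Sigma].
Proof.
have cs : compact [set: symbol] by apply: finite_compact; exact: (@finite_finset 'I_3 setT).
have := @tychonoff nat (fun=> symbol) (fun=> setT) (fun=> cs).
by rewrite (_ : [set f | _] = setT)//; apply/seteqP; split.
Qed.

Lemma continuous_Sigma_bounded (R : realType) (f : Sigma -> R) : continuous f ->
  exists C : R, 0 < C /\ forall x, `|f x| <= C.
Proof.
move=> cf; have : compact (f @` [set: Sigma]).
  by apply: continuous_compact; [exact: continuous_subspaceT|exact: compact_Sigma].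
move=> /compact_bounded[M [_ MP]]; exists (`|M| + 1); split.
  by rewrite ltr_wpDl.
move=> x; apply: (MP (`|M| + 1)); last by exists x.
by rewrite ltr_pwDr// ler_norm.
Qed.

Lemma integral_two_deltas (R : realType) (a b : {nonneg R}) (f : BSigma -> R) :
  measurable_fun [set: BSigma] f ->
  (\int[two_deltas a b]_x (f x)%:E = (a%:num * f zeros + b%:num * f ones)%:E)%E.
Proof.
move=> mf; have mF : measurable_fun [set: BSigma] (EFin \o f) by exact/measurable_EFinP.
have G (h : BSigma -> \bar R) : measurable_fun [set: BSigma] h -> (forall x, 0 <= h x)%E ->
    (\int[two_deltas a b]_x h x = a%:num%:E * h zeros + b%:num%:E * h ones)%E.
  move=> mh h0; rewrite /two_deltas ge0_integral_measure_add//.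
  rewrite !ge0_integral_mscale// !integral_dirac//.
  by rewrite !diracT !mul1e.
rewrite integralE !G//; [|exact: measurable_funeneg|exact: measurable_funepos].
rewrite !funeposE !funenegE /= -!EFin_max -!EFinM.
rewrite -EFinB; congr EFin.
have e (x : R) : Num.max x 0 = x + Num.max (- x) 0.
  by have [h|h] := leP x 0; have [h'|h'] := leP (- x) 0; lra.
by rewrite (e (f zeros)) (e (f ones)); ring.
Qed.

Section WeakLimit.
Context {R : realType}.
Variables (alpha : R) (mu : R -> probability BSigma R).
Hypothesis alpha0 : 0 < alpha.
Hypothesis hmu : forall beta : R, 0 < beta ->
  equilibrium_state (sigma_shift : BSigma -> BSigma)
    (fun x => beta * potential alpha x) (mu beta).

Local Notation pot := (potential alpha).

Lemma gap_lt1 (beta : R) : 2 < beta -> gap alpha beta < 1.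
Proof.
move=> b2; have b0 : 0 < beta by lra.
apply: (le_lt_trans (gap_le _ _ alpha0 b0)).
have h := expRN_le_inv _ _ b0.
have : beta^-1 < 1 / 2 by rewrite -[1 / 2]invrK ltf_pV2 ?posrE// ?invf_div; lra.
lra.
Qed.

Let mass (beta : R) : R := \int[mu beta]_x (x 0%N == o0)%:R.

Lemma mass_asymptotic (e : R) : 0 < e ->
  \forall beta \near +oo, `|mass beta - (1 + excursion_ratio alpha beta)^-1| <= e.
Proof.
move=> e0; pose s := Num.min (e / 4) (1 / 8).
have s0 : 0 < s by rewrite lt_min !divr_gt0.
have s8 : s <= 1 / 8 by rewrite ge_min lexx orbT.
have se : s <= e / 4 by rewrite ge_min lexx.
exists (Num.max 2 (60 * (17 + alpha^-1) / s ^+ 2)); split; first exact: num_real.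
move=> beta; rewrite gt_max => /andP[b2 bs]; have b0 : 0 < beta by lra.
have s01 : 0 < s <= 1 / 8 by rewrite s0.
apply: (le_trans (mass_close alpha beta (mu beta) alpha0 b0 (hmu _ b0) (gap_lt1 _ b2) s s01 _)); last by lra.
by rewrite -ler_pdivrMr ?exprn_gt0// ltW.
Qed.

Definition outside n : set BSigma := ~` (cyl n zeros `|` cyl n ones).

Lemma measurable_outside n : measurable (outside n).
Proof. by apply/measurableC/measurableU; exact: measurable_cyl R _ _. Qed.

Lemma potential_outside n x : pot x <= - (Num.min (2 ^- n.+1) alpha) * \1_(outside n.+1) x.
Proof.
set k := Num.min _ _.
have k0 : 0 < k by rewrite lt_min invr_gt0 exprn_gt0.
have kn : k <= 2 ^- n.+1 by rewrite ge_min lexx.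
have ka : k <= alpha by rewrite ge_min lexx orbT.
have pot0 : pot x <= 0.
  have d0 := @dist_ge0 R x zeros; have d1 := @dist_ge0 R x ones; have a0 := alpha0.
  by rewrite /potential; case: (ord3P (x 0%N)) => -> /=; lra.
rewrite indicE; case: (boolP (x \in outside n.+1)) => [|_]; last by rewrite mulr0.
rewrite inE mulr1 => xo.
have far (y : Sigma) : ~ cyl n.+1 y x -> 2 ^- n.+1 <= dist R x y.
  move=> xy; rewrite leNgt; apply/negP => /dist_lt h; apply: xy => i ilt.
  by apply: h; exact: ltnW.
have d0 : 2 ^- n.+1 <= dist R x zeros by apply: far => h; apply: xo; left.
have d1 : 2 ^- n.+1 <= dist R x ones by apply: far => h; apply: xo; right.
by rewrite /potential; case: (ord3P (x 0%N)) => -> /=; lra.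
Qed.

(** A Chebyshev bound: [potential_outside] gives [\int pot <= - k * mu (outside n.+1)], while
    [potential_ge] keeps [\int pot] above [- (ln 3 / beta)]. *)
Lemma outside_asymptotic n (e : R) : 0 < e ->
  \forall beta \near +oo, fine (mu beta (outside n.+1)) <= e.
Proof.
move=> e0; set k := Num.min (2 ^- n.+1) alpha.
have k0 : 0 < k by rewrite lt_min invr_gt0 exprn_gt0.
exists (Num.max 2 (ln 3 / (k * e))); split; first exact: num_real.
move=> beta; rewrite gt_max => /andP[b2 be]; have b0 : 0 < beta by lra.
have := potential_ge alpha beta (mu beta) alpha0 b0 (hmu _ b0) (gap_lt1 _ b2).
have : \int[mu beta]_x pot x <= \int[mu beta]_x (- k * \1_(outside n.+1) x).
  apply: le_Rint; [exact: potential_bdd_mfun| |exact: potential_outside].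
  by apply: bdd_mfunZ; apply: bdd_mfun_indic; exact: measurable_outside.
rewrite RintZ; last by apply: bdd_mfun_indic; exact: measurable_outside.
rewrite Rint_indic; last exact: measurable_outside.
move=> h1 h2; have ke : 0 < k * e by rewrite mulr_gt0.
rewrite ltr_pdivrMr// in be.
have : ln 3 / beta <= k * e by rewrite ler_pdivrMr// mulrC ltW.
move=> h3; rewrite -(ler_pM2l k0); lra.
Qed.

Lemma weak_limit (c : R) (f : Sigma -> R) : continuous f ->
  (1 + excursion_ratio alpha beta)^-1 @[beta --> +oo] --> c ->
  (\int[mu beta]_x (f x)%:E)%E @[beta --> +oo] --> (c * f zeros + (1 - c) * f ones)%:E.
Proof.
move=> cf cc; have [C [C0 fC]] := continuous_Sigma_bounded _ _ cf.
have bf : bdd_mfun (f : BSigma -> R) by apply: continuous_bdd_mfun => //; exists C.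
under eq_fun do rewrite EFin_Rint//.
apply: cvg_EFin; first exact: nearW.
apply/cvgrPdist_le => e e0.
have e4 : 0 < e / 4 by rewrite divr_gt0.
have near_fix y : exists n, forall x, cyl n y x -> `|f x - f y| <= e / 4.
  have /cvgrPdist_le/(_ _ e4)/(nbhs_cyl R)[n nP] := cf y.
  by exists n => x /nP /=; rewrite distrC.
have [n0 P0] := near_fix zeros; have [n1 P1] := near_fix ones.
(* Cylinders of length [n.+1] are used below, so that membership fixes the first symbol and with it
   the value of [L]. *)
pose n := maxn n0 n1.
have Q0 x : cyl n.+1 zeros x -> `|f x - f zeros| <= e / 4.
  by move=> h; apply: P0 => i ilt; apply: h; rewrite ltnS leq_max (ltnW ilt).
have Q1 x : cyl n.+1 ones x -> `|f x - f ones| <= e / 4.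
  by move=> h; apply: P1 => i ilt; apply: h; rewrite ltnS leq_max (ltnW ilt) orbT.
have e' : 0 < e / 8 / C by rewrite !divr_gt0.
have H1 := outside_asymptotic n _ e'.
have e16 : 0 < e / 16 / C by rewrite !divr_gt0.
have H2 := mass_asymptotic _ e16.
move/cvgrPdist_le : cc => /(_ _ e16) H3.
near=> beta; rewrite /=.
have h1 : fine (mu beta (outside n.+1)) <= e / 8 / C by near: beta.
have h2 : `|mass beta - (1 + excursion_ratio alpha beta)^-1| <= e / 16 / C by near: beta.
have h3 : `|c - (1 + excursion_ratio alpha beta)^-1| <= e / 16 / C by near: beta.
set F := Rintegral _ _ _.
have bi : bdd_mfun (fun x : BSigma => (x 0%N == o0)%:R : R).
  exact: (bdd_mfun_two (fun a _ => (a == o0)%:R)).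
(* [f] is compared with a function of the first symbol only. Replacing [f] by [L] costs
   [\int h <= e / 2], and replacing the mass by [c] costs [e / 4]. *)
pose L (x : BSigma) : R := (f zeros - f ones) * (x 0%N == o0)%:R + f ones.
have bL : bdd_mfun L by apply: bdd_mfunD; [exact: bdd_mfunZ|exact: bdd_mfun_cst].
have LE : \int[mu beta]_x L x = mass beta * f zeros + (1 - mass beta) * f ones.
  rewrite RintD; [|exact: bdd_mfunZ|exact: bdd_mfun_cst].
  by rewrite RintZ// Rint_cst -/(mass beta); ring.
pose h (x : BSigma) : R := 2 * C * \1_(outside n.+1) x + e / 4.
have bo : bdd_mfun (\1_(outside n.+1) : BSigma -> R).
  by apply: bdd_mfun_indic; exact: measurable_outside.
have bh : bdd_mfun h by apply: bdd_mfunD; [exact: bdd_mfunZ|exact: bdd_mfun_cst].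
have hE : \int[mu beta]_x h x = 2 * C * fine (mu beta (outside n.+1)) + e / 4.
  rewrite RintD; [|exact: bdd_mfunZ|exact: bdd_mfun_cst].
  by rewrite RintZ// Rint_cst Rint_indic//; exact: measurable_outside.
have fL x : `|f x - L x| <= h x.
  rewrite /h indicE; case: (boolP (x \in outside n.+1)) => [_|].
    have := fC x; have := fC zeros; have := fC ones.
    rewrite /L !ler_norml => /andP[? ?] /andP[? ?] /andP[? ?].
    by case: (_ == _); rewrite /=; apply/andP; split; lra.
  rewrite notin_setE => /contrapT xc; rewrite mulr0 add0r /L; case: xc => xc.
    by rewrite (xc 0%N)//= mulr1 subrK; exact: Q0.
  by rewrite (xc 0%N)//= mulr0 add0r; exact: Q1.
have up : F <= \int[mu beta]_x (L x + h x).
  apply: le_Rint => //; first exact: bdd_mfunD.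
  by move=> x; have /ler_normlP[_ ?] := fL x; lra.
have lo : \int[mu beta]_x L x <= \int[mu beta]_x (f x + h x).
  apply: le_Rint => //; first exact: bdd_mfunD.
  by move=> x; have /ler_normlP[? _] := fL x; lra.
rewrite RintD// hE LE in up; rewrite RintD// hE LE -/F in lo.
have Ch1 : C * fine (mu beta (outside n.+1)) <= e / 8.
  by rewrite mulrC -ler_pdivlMr.
have mc : `|mass beta - c| <= e / 8 / C.
  have -> : mass beta - c = (mass beta - (1 + excursion_ratio alpha beta)^-1) - (c - (1 + excursion_ratio alpha beta)^-1) by ring.
  by apply: (le_trans (ler_normB _ _)); lra.
have : `|(mass beta - c) * (f zeros - f ones)| <= e / 8 / C * (2 * C).
  rewrite normrM; apply: ler_pM => //.
  by apply: (le_trans (ler_normB _ _)); have := fC zeros; have := fC ones; lra.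
rewrite (_ : e / 8 / C * (2 * C) = e / 4); last by field; rewrite gt_eqF.
rewrite ler_norml => /andP[g1 g2].
rewrite ler_norml; apply/andP; split; lra.
Unshelve. all: by end_near.
Qed.

End WeakLimit.

(** * Limit of the excursion ratio in the three regimes *)

Section RatioLimit.
Context {R : realType}.
Variable alpha : R.
Local Notation A := (excursion_ratio alpha).

Let inv_ratio_dist (a : R) : 0 < a -> `|(1 + a)^-1 - 1 / 2| <= `|1 - a| /\ `|1 - (1 + a)^-1| <= a.
Proof.
move=> a0; have an : 1 + a != 0 by rewrite gt_eqF// addr_gt0.
have i1 : (1 + a)^-1 <= 1 by rewrite invf_le1 ?addr_gt0// lerDl ltW.
have i0 : 0 < (1 + a)^-1 by rewrite invr_gt0 addr_gt0.
split.
  have -> : (1 + a)^-1 - 1 / 2 = (1 - a) * ((1 + a)^-1 / 2) by field.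
  rewrite normrM ler_piMr// ger0_norm; lra.
have -> : 1 - (1 + a)^-1 = a * (1 + a)^-1 by field.
by rewrite ger0_norm ?mulr_ge0 ?ler_piMr// ltW.
Qed.

(** Since the gap is at least [expR (- (2 * beta))], [1 - A beta = gap_r / gap] is at most
    [expR (- ((alpha - 1) * beta))]. *)
Lemma inv_ratio_cvg_gt1 : 1 < alpha -> (1 + A beta)^-1 @[beta --> +oo] --> (2^-1 : R).
Proof.
move=> al; apply/cvgrPdist_le => e e0.
have a10 : 0 < alpha - 1 by rewrite subr_gt0.
exists (Num.max 0 ((alpha - 1) * e)^-1); split; first exact: num_real.
move=> beta; rewrite gt_max => /andP[b0 be].
have g0 := gap_gt0 alpha beta.
have AE := excursion_ratioE alpha beta; have A0 := excursion_ratio_gt0 alpha beta.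
have [h _] := inv_ratio_dist _ A0.
rewrite distrC -[2^-1]mul1r; apply: (le_trans h).
have -> : 1 - A beta = gap_r alpha beta / gap alpha beta by rewrite -AE addrAC subrr add0r.
have rg0 : 0 <= gap_r alpha beta / gap alpha beta by rewrite divr_ge0 ?expR_ge0// ltW.
rewrite ger0_norm// ler_pdivrMr//.
have x0 : 0 < (alpha - 1) * beta by rewrite mulr_gt0.
have h1 : expR (- ((alpha - 1) * beta)) <= e.
  apply: (le_trans (expRN_le_inv _ _ x0)).
  rewrite -[leRHS]invrK lef_pV2 ?posrE ?invr_gt0// mulrC -ler_pdivrMr//.
  by rewrite -invfM mulrC ltW.
apply: (@le_trans _ _ (expR (- ((alpha - 1) * beta)) * expR (- (2 * beta)))).
  by rewrite -expRD ler_expR; lra.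
by apply: ler_pM; rewrite ?expR_ge0//; exact: gap_ge.
Qed.

(** Since the gap is at least [gap_r], [A beta] is at most [gap_q / gap_r ^+ 2], which decays
    exponentially in [(1 - alpha) * beta]. *)
Lemma inv_ratio_cvg_lt1 : alpha < 1 -> (1 + A beta)^-1 @[beta --> +oo] --> (1 : R).
Proof.
move=> al; apply/cvgrPdist_le => e e0.
have a10 : 0 < 1 - alpha by rewrite subr_gt0.
exists (Num.max 0 ((1 - alpha) * e)^-1); split; first exact: num_real.
move=> beta; rewrite gt_max => /andP[b0 be].
have g0 := gap_gt0 alpha beta; have A0 := excursion_ratio_gt0 alpha beta.
have [_ h] := inv_ratio_dist _ A0.
apply: (le_trans h).
have rg : gap_r alpha beta <= gap alpha beta.
  rewrite -(ler_pM2r g0) -expr2 gap_eq lerDl; exact: expR_ge0.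
have x0 : 0 < (1 - alpha) * beta by rewrite mulr_gt0.
have h1 : expR (- ((1 - alpha) * beta)) <= e.
  apply: (le_trans (expRN_le_inv _ _ x0)).
  rewrite -[leRHS]invrK lef_pV2 ?posrE ?invr_gt0// mulrC -ler_pdivrMr//.
  by rewrite -invfM mulrC ltW.
rewrite /excursion_ratio ler_pdivrMr ?exprn_gt0//.
apply: (@le_trans _ _ (expR (- ((1 - alpha) * beta)) * gap_r alpha beta ^+ 2)).
  by rewrite -expRM_natl -expRD ler_expR; nra.
apply: ler_pM => //; rewrite ?expR_ge0 ?sqr_ge0//.
by rewrite ler_sqr ?nnegrE ?expR_ge0// ltW.
Qed.

(** Here [gap_q = gap_r ^+ 2], so [gap_eq] is the golden ratio equation scaled by [gap_r], and
    [A beta] is the inverse square of the golden ratio for every [beta]. *)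
Lemma inv_ratio_eq1 beta : alpha = 1 ->
  (1 + A beta)^-1 = golden R ^+ 2 / (1 + golden R ^+ 2).
Proof.
move=> a1; have gq : gap_q beta = gap_r alpha beta ^+ 2.
  by rewrite -expRM_natl; congr expR; rewrite a1; ring.
have r0 : 0 < gap_r alpha beta by exact: expR_gt0.
have gE : gap alpha beta = gap_r alpha beta * golden R.
  rewrite /gap /golden gq (_ : _ ^+ 2 + _ = gap_r alpha beta ^+ 2 * 5); last by ring.
  by rewrite sqrtrM ?sqr_ge0// sqrtr_sqr gtr0_norm//; field.
have gr0 := golden_gt0 R.
rewrite /excursion_ratio gE gq; field.
by rewrite !gt_eqF// ?addr_gt0 ?exprn_gt0.
Qed.

End RatioLimit.

Theorem mainTheorem1 (R : realType) (alpha : R) (halpha : 0 < alpha)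
    (mu : R -> probability BSigma R)
    (hmu : forall beta : R, 0 < beta ->
       equilibrium_state (sigma_shift : BSigma -> BSigma)
         (fun x => beta * potential alpha x) (mu beta)) :
  [/\ 1 < alpha ->
        weak_star_cvg mu +oo (two_deltas (2^-1)%:nng (2^-1)%:nng),
      alpha = 1 ->
        weak_star_cvg mu +oo
          (two_deltas (golden R ^+ 2 / (1 + golden R ^+ 2))%:nng
                      (1 / (1 + golden R ^+ 2))%:nng)
    & alpha < 1 -> weak_star_cvg mu +oo (dirac (zeros : BSigma)) ].
Proof.
have mf (f : Sigma -> R) : continuous f -> measurable_fun [set: BSigma] (f : BSigma -> R).
  move=> cf; have [C [_ fC]] := continuous_Sigma_bounded _ _ cf.
  by apply: (continuous_bdd_mfun _ _ cf _).1; exists C.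
split=> [al|al|al] f cf.
- rewrite integral_two_deltas; last exact: mf.
  have := weak_limit alpha mu halpha hmu _ f cf (inv_ratio_cvg_gt1 alpha al).
  by rewrite /= (_ : 1 - 2^-1 = 2^-1 :> R); last by field.
- rewrite integral_two_deltas; last exact: mf.
  have cc : (1 + excursion_ratio alpha beta)^-1 @[beta --> +oo] -->
      golden R ^+ 2 / (1 + golden R ^+ 2).
    by under eq_fun do rewrite inv_ratio_eq1//; exact: cvg_cst.
  have := weak_limit alpha mu halpha hmu _ f cf cc.
  rewrite /= (_ : 1 - golden R ^+ 2 / (1 + golden R ^+ 2) = 1 / (1 + golden R ^+ 2))//.
  by field; rewrite gt_eqF// addr_gt0// exprn_gt0// golden_gt0.
- rewrite integral_dirac//; last by apply/measurable_EFinP; exact: mf.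
  have := weak_limit alpha mu halpha hmu _ f cf (inv_ratio_cvg_lt1 alpha al).
  by rewrite diracT mul1e mul1r subrr mul0r addr0.
Qed.
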